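(* Let $c_2\in\mathrm{Hom}_C(C[x],C)$ be such that $\mathfrak{h}(c_2(x)+i)\neq 0$ for every $i\in\mathbb{Z}$, and suppose that $k_0\otimes_D\mathcal{R}$ (tensor product formed via $c_2:D\to k_0$) is not the zero ring. Let $\mathbf{n}$ be a maximal $\delta$-ideal of $k_0\otimes_D\mathcal{R}$ and put $\mathcal{S}_{\delta,c_2}=(k_0\otimes_D\mathcal{R})/\mathbf{n}$. Then $\mathrm{stab}(\mathbf{n})$ is the $\delta$-Galois group of $\mathcal{S}_{\delta,c_2}$ over $k_0$.
   Context: Conventions: rings are commutative with $1$, fields have characteristic $0$. A $\sigma\delta$-ring is a ring with an automorphism $\sigma$ and a derivation $\delta$ that commute; $\sigma$-rings and $\delta$-rings have only the respective operator. A $\sigma\delta$- (resp. $\sigma$-, $\delta$-) ideal is an ideal stable under the operators; a ring with operators is simple if it is nonzero and its only such ideals are $(0)$ and itself. $S^{\sigma}$, $S^{\delta}$, $S^{\sigma\delta}$ denote constants: elements with $\sigma(s)=s$, with $\delta(s)=0$, with both, respectively. ''Maximal $\delta$-ideal'' means maximal among proper $\delta$-ideals. Standing data: $\mathcal{D}$ is an integral domain which is a simple $\delta$-ring, finitely generated over the algebraically closed field $C=\mathcal{D}^\delta$; $k_0$ is its field of fractions (so $k_0^\delta=C$). $k_0(x)$ is the $\sigma\delta$-field with $\sigma|_{k_0}=\mathrm{id}$, $\sigma(x)=x+1$, $\delta(x)=0$. Consider the system $\sigma(Y)=AY,\ \delta(Y)=BY$ with $A\in\mathrm{GL}_n(k_0(x))$,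 $B\in\mathrm{gl}_n(k_0(x))$ and $\sigma(B)A=\delta(A)+AB$. $R$ is a $\sigma\delta$-Picard-Vessiot ring over $k_0(x)$ for it: $R$ is a simple $\sigma\delta$-ring containing $k_0(x)$ and $R=k_0(x)[\mathcal{X},1/\det(\mathcal{X})]$ with $\mathcal{X}\in\mathrm{GL}_n(R)$ satisfying the system; $\mathcal{X}$ is fixed. $\mathfrak{h}\in\mathcal{D}[x]\setminus\{0\}$ is such that all entries of $A,B$ lie in $\mathcal{D}[x,1/\mathfrak{h}]$; $D=\mathcal{D}[x][\{1/\sigma^i(\mathfrak{h}) : i\in\mathbb{Z}\}]$; $\mathcal{R}=D[\mathcal{X},1/\det(\mathcal{X})]$, and $\mathcal{R}$ is a $\sigma\delta$-subring of $R$. Group: for matrices, $(a_{ij})\otimes(b_{ij}):=(\sum_l a_{il}\otimes b_{lj})$. Put $\mathcal{Z}=\mathcal{X}^{-1}\otimes_{k_0(x)}\mathcal{X}$, $C[G]=(R\otimes_{k_0(x)}R)^{\sigma\delta}=C[\mathcal{Z},1/\det(\mathcal{Z})]$, and $G=\mathrm{Hom}_C(C[G],C)$, the affine algebraic group identified with the group $\sigma\delta\text{-}\mathrm{Gal}(R/k_0(x))$ of $\sigma\delta$-automorphisms of $R$ over $k_0(x)$ via $g\mapsto\tau_g$, $\tau_g(\mathcal{X})=\mathcal{X}g(\mathcal{Z})$. Via $g\mapsto g(\mathcal{Z})$, $G$ is an algebraic subgroup of $\mathrm{GL}_n(C)$. Specialization: when $\mathfrak{h}(c_2(x)+i)\neq0$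 for all $i\in\mathbb{Z}$, $c_2\in\mathrm{Hom}_C(C[x],C)$ extends uniquely to a $\mathcal{D}$-homomorphism $c_2:D\to k_0$ (substituting $c_2(x)$ for $x$), which is a $\delta$-homomorphism. $B^{c_2}$ is obtained by applying $c_2$ to the entries. $T=k_0\otimes_D\mathcal{R}$ is a $\delta$-ring if nonzero. For $g\in G$, $\rho_g:T\to T$ is the $k_0$-algebra automorphism with $\rho_g(1\otimes\mathcal{X})=(1\otimes\mathcal{X})g(\mathcal{Z})$, and $\mathrm{stab}(\mathbf{n})=\{g\in G:\rho_g(\mathbf{n})\subseteq\mathbf{n}\}$. The ring $\mathcal{S}_{\delta,c_2}$ is a $\delta$-Picard-Vessiot ring over $k_0$ for $\delta(Y)=B^{c_2}Y$ with fundamental matrix $\bar{\mathcal{X}}=1\otimes\mathcal{X}\bmod\mathbf{n}$; its $\delta$-Galois group is the group of $\delta$-automorphisms of $\mathcal{S}_{\delta,c_2}$ over $k_0$, identified with the algebraic group $\mathrm{Hom}_C((\mathcal{S}_{\delta,c_2}\otimes_{k_0}\mathcal{S}_{\delta,c_2})^\delta,C)$ and embedded in $\mathrm{GL}_n(C)$ via $\tau\mapsto\bar{\mathcal{X}}^{-1}\tau(\bar{\mathcal{X}})$. *)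

(* Defs.v *)
From HB Require Import structures.
From mathcomp Require Import all_boot all_algebra generic_quotient.
From mathcomp Require Import boolp classical_sets.

Set Implicit Arguments.
Unset Strict Implicit.
Unset Printing Implicit Defensive.

Import GRing.Theory.
Local Open Scope ring_scope.
Local Open Scope quotient_scope.
Local Open Scope classical_set_scope.

(* Rings are comPzRingType (commutative with 1, possibly zero), since a tensor
   product of nonzero rings may vanish. *)

Section Operators.
Variable R : comPzRingType.
Implicit Types (I : set R) (s d : R -> R).

Definition derivation d : Prop :=
  (forall a b, d (a + b) = d a + d b) /\
  (forall a b, d (a * b) = d a * b + a * d b).

Definition is_ideal I : Prop :=
  [/\ I 0, forall a b, I a -> I b -> I (a + b) & forall r a, I a -> I (r * a)].

Definition stable s I : Prop := forall a, I a -> I (s a).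

Definition d_ideal d I : Prop := is_ideal I /\ stable d I.

Definition sd_ideal s d I : Prop := [/\ is_ideal I, stable s I & stable d I].

Definition d_simple d : Prop :=
  (1 : R) != 0 /\ forall I, d_ideal d I -> I = [set 0] \/ I = setT.

Definition sd_simple s d : Prop :=
  (1 : R) != 0 /\ forall I, sd_ideal s d I -> I = [set 0] \/ I = setT.

Definition maximal_d_ideal d I : Prop :=
  [/\ d_ideal d I, I <> setT
    & forall J, d_ideal d J -> I `<=` J -> J <> setT -> J = I].

Definition constants s d : set R := [set a | s a = a /\ d a = 0].

End Operators.

(* [adjoin gens] is the subring of R generated by the set [gens], as a ring. *)
Section GeneratedSubring.
Variable R : comPzRingType.
Implicit Type gens : set R.

Definition gen_subring gens : {pred R} := fun r : R =>
  `[< forall S : {pred R}, subring_closed S ->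
        (forall a, gens a -> a \in S) -> r \in S >].

Lemma gen_subring_closed gens : subring_closed (gen_subring gens).
Proof.
split.
- by apply/asboolP => S [].
- move=> a b /asboolP Sa /asboolP Sb; apply/asboolP => S clS gS.
  by case: (clS) => _ SB _; apply: SB; [apply: Sa | apply: Sb].
- move=> a b /asboolP Sa /asboolP Sb; apply/asboolP => S clS gS.
  by case: (clS) => _ _ SM; apply: SM; [apply: Sa | apply: Sb].
Qed.

Lemma mem_gen_subring gens a : gens a -> a \in gen_subring gens.
Proof. by move=> ga; apply/asboolP => S _; apply. Qed.

Record adjoin gens := Adjoin {
  adjoin_val :> R;
  adjoin_valP : adjoin_val \in gen_subring gens }.

HB.instance Definition _ gens := [isSub for @adjoin_val gens].
HB.instance Definition _ gens := [Choice of adjoin gens by <:].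
HB.instance Definition _ gens :=
  GRing.SubChoice_isSubComPzRing.Build R (gen_subring gens) (adjoin gens)
    (gen_subring_closed gens).

(* Restriction of an operator under which the subring is stable. *)
Definition restrict gens (s : R -> R) (a : adjoin gens) : adjoin gens :=
  insubd (0 : adjoin gens) (s (val a)).

End GeneratedSubring.

(* The tensor product B (x)_A M of two A-algebras f : A -> B and g : A -> M. *)
Section Tensor.
Variables (A : Type) (B M : comPzRingType) (f : A -> B) (g : A -> M).

Definition balanced (V : zmodType) (phi : B -> M -> V) : Prop :=
  [/\ forall b b' m, phi (b + b') m = phi b m + phi b' m,
      forall b m m', phi b (m + m') = phi b m + phi b m'
    & forall a b m, phi (f a * b) m = phi b (g a * m)].

(* A list [:: (b_1, m_1); ...] stands for the sum of the b_i (x) m_i.  Two such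
   sums are equal in the tensor product iff every A-balanced biadditive map
   takes the same value on them. *)
Definition tensor_eq (s t : seq (B * M)) : bool :=
  `[< forall (V : zmodType) (phi : B -> M -> V), balanced phi ->
        \sum_(p <- s) phi p.1 p.2 = \sum_(p <- t) phi p.1 p.2 >].

Lemma tensor_eq_refl : reflexive tensor_eq.
Proof. by move=> s; apply/asboolP. Qed.
Lemma tensor_eq_sym : symmetric tensor_eq.
Proof.
move=> s t; apply/asboolP/asboolP => st V phi bal; exact/esym/st.
Qed.
Lemma tensor_eq_trans : transitive tensor_eq.
Proof.
move=> t s u /asboolP st /asboolP tu; apply/asboolP => V phi bal.
by rewrite st // tu.
Qed.

Canonical tensor_equiv :=
  EquivRel tensor_eq tensor_eq_refl tensor_eq_sym tensor_eq_trans.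

Definition tensor := {eq_quot tensor_equiv}.
HB.instance Definition _ : EqQuotient _ tensor_equiv tensor :=
  EqQuotient.on tensor.
HB.instance Definition _ := Choice.on tensor.

Definition tens (b : B) (m : M) : tensor := \pi_tensor [:: (b, m)].

Definition tensor_add (u v : tensor) : tensor := \pi_tensor (repr u ++ repr v).
Definition tensor_opp (u : tensor) : tensor :=
  \pi_tensor [seq (- p.1, p.2) | p <- repr u].
Definition tensor_mul (u v : tensor) : tensor :=
  \pi_tensor [seq (p.1 * q.1, p.2 * q.2) | p <- repr u, q <- repr v].

Lemma tensor_piP (s t : seq (B * M)) :
  (forall (V : zmodType) (phi : B -> M -> V), balanced phi ->
     \sum_(p <- s) phi p.1 p.2 = \sum_(p <- t) phi p.1 p.2) ->
  \pi_tensor s = \pi_tensor t.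
Proof. by move=> st; apply/eqquotP/asboolP. Qed.

Lemma tensor_reprE s (V : zmodType) (phi : B -> M -> V) : balanced phi ->
  \sum_(p <- repr (\pi_tensor s)) phi p.1 p.2 = \sum_(p <- s) phi p.1 p.2.
Proof.
move=> bal; have /eqquotP /asboolP : repr (\pi_tensor s) = s %[mod tensor].
  by rewrite reprK.
exact.
Qed.

Lemma balanced0 (V : zmodType) (phi : B -> M -> V) m :
  balanced phi -> phi 0 m = 0.
Proof. by case=> H _ _; apply: (addrI (phi 0 m)); rewrite -H !addr0. Qed.

Lemma balancedN (V : zmodType) (phi : B -> M -> V) b m :
  balanced phi -> phi (- b) m = - phi b m.
Proof.
move=> bal; case: (bal) => H _ _.
by apply/eqP; rewrite -addr_eq0 -H addNr balanced0.
Qed.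

Lemma balanced_mul (V : zmodType) (phi : B -> M -> V) c k : balanced phi ->
  balanced (fun b m => phi (b * c) (m * k)).
Proof.
by case=> H1 H2 H3; split=> *; rewrite ?mulrDl ?H1 ?H2 // -!mulrA H3.
Qed.

Lemma balanced_sum (V : zmodType) I (r : seq I) (phi : I -> B -> M -> V) :
  (forall i, balanced (phi i)) ->
  balanced (fun b m => \sum_(i <- r) phi i b m).
Proof.
move=> bal; split=> *; rewrite -?big_split; apply: eq_bigr => i _;
  by case: (bal i).
Qed.

Lemma tensor_ind (P : tensor -> Prop) :
  (forall s, P (\pi_tensor s)) -> forall u, P u.
Proof. by move=> Ps u; rewrite -[u]reprK. Qed.

Lemma tensor_addE s t :
  tensor_add (\pi_tensor s) (\pi_tensor t) = \pi_tensor (s ++ t).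
Proof.
by apply/tensor_piP => V phi bal; rewrite !big_cat /= !tensor_reprE.
Qed.

Lemma tensor_oppE s :
  tensor_opp (\pi_tensor s) = \pi_tensor [seq (- p.1, p.2) | p <- s].
Proof.
apply/tensor_piP => V phi bal; rewrite !big_map /=.
under eq_bigr do rewrite balancedN //.
by under [RHS]eq_bigr do rewrite balancedN //; rewrite !sumrN tensor_reprE.
Qed.

Lemma tensor_mulE s t :
  tensor_mul (\pi_tensor s) (\pi_tensor t) =
  \pi_tensor [seq (p.1 * q.1, p.2 * q.2) | p <- s, q <- t].
Proof.
apply/tensor_piP => V phi bal; rewrite !big_allpairs_dep /=.
rewrite (@tensor_reprE s V (fun b m =>
  \sum_(q <- repr (\pi_tensor t)) phi (b * q.1) (m * q.2))).
  apply: eq_bigr => p _.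
  apply: (@tensor_reprE t V (fun b m => phi (p.1 * b) (p.2 * m))).
  rewrite (_ : (fun _ _ => _) = fun b m => phi (b * p.1) (m * p.2)).
    exact: balanced_mul.
  by apply/funext => b; apply/funext => m; rewrite mulrC [_ * m]mulrC.
by apply: balanced_sum => q; apply: balanced_mul.
Qed.

Fact tensor_addA : associative tensor_add.
Proof.
elim/tensor_ind=> s; elim/tensor_ind=> t; elim/tensor_ind=> u.
by rewrite !tensor_addE catA.
Qed.
Fact tensor_addC : commutative tensor_add.
Proof.
elim/tensor_ind=> s; elim/tensor_ind=> t; rewrite !tensor_addE.
by apply/tensor_piP => V phi bal; rewrite !big_cat /= addrC.
Qed.
Fact tensor_add0 : left_id (\pi_tensor [::]) tensor_add.
Proof. by elim/tensor_ind=> s; rewrite tensor_addE. Qed.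
Fact tensor_addN : left_inverse (\pi_tensor [::]) tensor_opp tensor_add.
Proof.
elim/tensor_ind=> s; rewrite tensor_oppE tensor_addE.
apply/tensor_piP => V phi bal; rewrite big_cat big_nil big_map /=.
by under eq_bigr do rewrite balancedN //; rewrite sumrN addNr.
Qed.

HB.instance Definition _ := GRing.isZmodule.Build tensor
  tensor_addA tensor_addC tensor_add0 tensor_addN.

Fact tensor_mulA : associative tensor_mul.
Proof.
elim/tensor_ind=> s; elim/tensor_ind=> t; elim/tensor_ind=> u; rewrite !tensor_mulE.
apply/tensor_piP => V phi bal; rewrite !big_allpairs_dep /=.
apply: eq_bigr => p _; rewrite big_allpairs_dep; apply: eq_bigr => q _.
by apply: eq_bigr => r _; rewrite !mulrA.
Qed.
Fact tensor_mulC : commutative tensor_mul.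
Proof.
elim/tensor_ind=> s; elim/tensor_ind=> t; rewrite !tensor_mulE.
apply/tensor_piP => V phi bal; rewrite !big_allpairs_dep exchange_big /=.
by apply: eq_bigr => p _; apply: eq_bigr => q _; rewrite mulrC [_.2 * _]mulrC.
Qed.
Fact tensor_mul1 : left_id (tens 1 1) tensor_mul.
Proof.
elim/tensor_ind=> s; rewrite tensor_mulE.
apply/tensor_piP => V phi bal; rewrite big_allpairs_dep big_seq1 /=.
by apply: eq_bigr => p _; rewrite !mul1r.
Qed.
Fact tensor_mulDl : left_distributive tensor_mul +%R.
Proof.
elim/tensor_ind=> s; elim/tensor_ind=> t; elim/tensor_ind=> u.
rewrite /GRing.add /= tensor_addE !tensor_mulE tensor_addE.
by rewrite allpairs_cat.
Qed.

HB.instance Definition _ := GRing.Zmodule_isComPzRing.Build tensor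
  tensor_mulA tensor_mulC tensor_mul1 tensor_mulDl.

(* The endomorphism sB (x) sM. *)
Definition tensor_end (sB : B -> B) (sM : M -> M) (u : tensor) : tensor :=
  \pi_tensor [seq (sB p.1, sM p.2) | p <- repr u].

(* The derivation dB (x) 1 + 1 (x) dM. *)
Definition tensor_der (dB : B -> B) (dM : M -> M) (u : tensor) : tensor :=
  \pi_tensor ([seq (dB p.1, p.2) | p <- repr u] ++
               [seq (p.1, dM p.2) | p <- repr u]).

Lemma tensE u : u = \sum_(p <- repr u) tens p.1 p.2.
Proof.
rewrite -{1}[u]reprK; elim: (repr u) => [|[b m] s IHs]; first by rewrite big_nil.
by rewrite big_cons -IHs /GRing.add /= tensor_addE.
Qed.

Lemma tensDl b b' m : tens (b + b') m = tens b m + tens b' m.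
Proof.
rewrite /GRing.add /= tensor_addE; apply/tensor_piP => V phi [H _ _].
by rewrite !big_cons !big_nil !addr0 H.
Qed.

Lemma tensDr b m m' : tens b (m + m') = tens b m + tens b m'.
Proof.
rewrite /GRing.add /= tensor_addE; apply/tensor_piP => V phi [_ H _].
by rewrite !big_cons !big_nil !addr0 H.
Qed.

Lemma tens_bal a b m : tens (f a * b) m = tens b (g a * m).
Proof.
by apply/tensor_piP => V phi [_ _ H]; rewrite !big_cons !big_nil !addr0 H.
Qed.

Lemma tensM b b' m m' : tens b m * tens b' m' = tens (b * b') (m * m').
Proof. by rewrite {1}/GRing.mul /= tensor_mulE. Qed.

Lemma tensor_end_tens (sA : A -> A) (sB : {rmorphism B -> B})
    (sM : {rmorphism M -> M}) :
  (forall a, sB (f a) = f (sA a)) -> (forall a, sM (g a) = g (sA a)) ->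
  forall s, tensor_end sB sM (\pi_tensor s) =
    \pi_tensor [seq (sB p.1, sM p.2) | p <- s].
Proof.
move=> sf sg s; apply/tensor_piP => V phi [H1 H2 H3]; rewrite !big_map /=.
apply: (@tensor_reprE s V (fun b m => phi (sB b) (sM m))).
by split=> *; rewrite ?rmorphD ?H1 ?H2 // !rmorphM sf sg H3.
Qed.

Lemma tensor_der_tens (dA : A -> A) (dB : B -> B) (dM : M -> M) :
  derivation dB -> derivation dM ->
  (forall a, dB (f a) = f (dA a)) -> (forall a, dM (g a) = g (dA a)) ->
  forall s, tensor_der dB dM (\pi_tensor s) =
    \pi_tensor ([seq (dB p.1, p.2) | p <- s] ++ [seq (p.1, dM p.2) | p <- s]).
Proof.
move=> [dBD dBM] [dMD dMM] df dg s; apply/tensor_piP => V phi [H1 H2 H3].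
rewrite !big_cat !big_map /= -!big_split /=.
apply: (@tensor_reprE s V (fun b m => phi (dB b) m + phi b (dM m))).
split=> [b b' m|b m m'|a b m].
- by rewrite dBD !H1 addrACA.
- by rewrite dMD !H2 addrACA.
- by rewrite dBM dMM df dg H1 H2 !H3 -addrA addrCA addrA.
Qed.

End Tensor.

(* Extension of operators on an integral domain to its field of fractions. *)
Section Fractions.
Variable E : idomainType.

Definition frac_der (d : E -> E) (q : {fraction E}) : {fraction E} :=
  let: n := \n_(repr q) in let: m := \d_(repr q) in
  tofrac (d n * m - n * d m) / tofrac m ^+ 2.

Definition frac_end (s : E -> E) (q : {fraction E}) : {fraction E} :=
  tofrac (s \n_(repr q)) / tofrac (s \d_(repr q)).

End Fractions.

(* The base: [DD] is the domain written with a curly D, [dD] its derivation and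
   [iC] the inclusion of the field of constants C. *)
Section Base.
Variables (C : closedFieldType) (DD : idomainType).
Variables (iC : {rmorphism C -> DD}) (dD : DD -> DD).

Definition base_hyp : Prop :=
  [/\ [pchar C] =i pred0,
      derivation dD,
      d_simple dD,
      forall a, dD a = 0 <-> exists c, a = iC c
    & exists s : seq DD, forall a, a \in gen_subring (range iC `|` [set` s])].

Definition k0 : fieldType := {fraction DD}.
Definition dk0 : k0 -> k0 := frac_der dD.
Definition k0x : fieldType := {fraction {poly k0}}.

(* On k0(x): sigma is the identity on k0 and sends x to x + 1; delta extends
   the derivation of k0 by delta(x) = 0. *)
Definition sig : k0x -> k0x := frac_end (fun p : {poly k0} => p \Po ('X + 1)).
Definition del : k0x -> k0x := frac_der (map_poly dk0).

Definition k0_k0x (a : k0) : k0x := tofrac a%:P.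
Definition poly_k0x (p : {poly DD}) : k0x :=
  tofrac (map_poly (@tofrac DD : DD -> k0) p).
Definition C_k0 (c : C) : k0 := tofrac (iC c).

Variable h : {poly DD}.

Definition loc_h : {pred k0x} :=
  gen_subring (range poly_k0x `|` [set (poly_k0x h)^-1]).

(* sigma^i(h) is h(x + i). *)
Definition sigma_h (i : int) : {poly DD} := h \Po ('X + (i%:~R)%:P).

Definition gensD : set k0x :=
  range poly_k0x `|` [set (poly_k0x (sigma_h i))^-1 | i in [set: int]].

Definition Dring : comPzRingType := adjoin gensD.

(* c2 extended to D: the ring homomorphism p(x) |-> p(c2(x)) for p in DD[x];
   its values on the 1/sigma^i(h) are then forced. *)
Definition extends_c2 (c2 : {rmorphism {poly C} -> C})
    (c2D : {rmorphism Dring -> k0}) : Prop :=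
  forall (p : {poly DD}) (u : Dring),
    val u = poly_k0x p -> c2D u = tofrac p.[iC (c2 'X)].

End Base.

Section PicardVessiot.
Variables (C : closedFieldType) (DD : idomainType).
Variables (iC : {rmorphism C -> DD}) (dD : DD -> DD).
Variables (n : nat) (A B : 'M[k0x DD]_n).
Variables (R : comUnitRingType) (iR : {rmorphism k0x DD -> R}).
Variables (sR : {rmorphism R -> R}) (dR : R -> R) (X : 'M[R]_n).

Definition integrable_system : Prop :=
  A \in unitmx /\
  map_mx (@sig DD) B *m A = map_mx (del dD) A + A *m B.

Definition gens_X : set R :=
  [set r | exists i j, r = X i j] `|` [set (\det X)^-1].

(* R is a sigma-delta-Picard-Vessiot ring over k0(x) for sigma(Y) = A Y,
   delta(Y) = B Y, with fundamental matrix X; iR is the inclusion of k0(x). *)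
Definition sd_picard_vessiot : Prop :=
  [/\ [/\ bijective sR, derivation dR & forall r, sR (dR r) = dR (sR r)],
      (forall q, iR (sig q) = sR (iR q)) /\
      (forall q, iR (del dD q) = dR (iR q)),
      sd_simple sR dR,
      [/\ X \in unitmx, map_mx sR X = map_mx iR A *m X
        & map_mx dR X = map_mx iR B *m X]
    & forall r, r \in gen_subring (range iR `|` gens_X)].

Variable h : {poly DD}.

(* The ring written with a curly R: D[X, 1/det X]. *)
Definition gens_calR : set R :=
  [set iR (val u) | u in [set: Dring h]] `|` gens_X.

Definition calR : comPzRingType := adjoin gens_calR.

(* The automorphism sR has to restrict to an automorphism of calR, hence the
   equality of booleans rather than an implication. *)
Definition calR_sd_subring : Prop :=
  (forall r, (sR r \in gen_subring gens_calR) = (r \in gen_subring gens_calR)) /\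
  (forall r, r \in gen_subring gens_calR -> dR r \in gen_subring gens_calR).

Lemma D_calR_subproof (u : Dring h) : iR (val u) \in gen_subring gens_calR.
Proof. by apply: mem_gen_subring; left; exists u. Qed.

Definition D_calR (u : Dring h) : calR := Adjoin (D_calR_subproof u).

Lemma X_calR_subproof i j : X i j \in gen_subring gens_calR.
Proof. by apply: mem_gen_subring; right; left; exists i, j. Qed.

Definition X_calR : 'M[calR]_n :=
  \matrix_(i, j) (Adjoin (X_calR_subproof i j) : calR).

(* C[G]: the ring of sigma-delta-constants of R (x)_{k0(x)} R. These constants
   already form a subring, so generating a subring with them adds nothing. *)
Definition RR : comPzRingType := tensor iR iR.
Definition sRR : RR -> RR := tensor_end sR sR.
Definition dRR : RR -> RR := tensor_der dR dR.
Definition CG : comPzRingType := adjoin (constants sRR dRR).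

Definition C_RR (c : C) : RR := tens iR iR (iR (k0_k0x (C_k0 iC c))) 1.

Definition Zmat : 'M[RR]_n :=
  \matrix_(i, j) \sum_l tens iR iR (invmx X i l) (X l j).

Definition Zmat_CG : 'M[CG]_n :=
  \matrix_(i, j) insubd (0 : CG) (Zmat i j).

(* A ring homomorphism g : C[G] -> C is a point of G when it is C-linear. *)
Definition in_G (g : {rmorphism CG -> C}) : Prop :=
  forall (c : C) (z : CG), val z = C_RR c -> g z = c.

Definition GZ (g : {rmorphism CG -> C}) : 'M[C]_n := map_mx g Zmat_CG.

Variable c2D : {rmorphism Dring h -> k0 DD}.

(* The delta-ring k0 (x)_D calR, formed along c2 : D -> k0. *)
Definition Tring : comPzRingType := tensor c2D D_calR.
Definition dT : Tring -> Tring := tensor_der (dk0 dD) (restrict dR).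

Definition k0_T (a : k0 DD) : Tring := tens c2D D_calR a 1.
Definition calR_T (r : calR) : Tring := tens c2D D_calR 1 r.
Definition C_T (c : C) : Tring := k0_T (C_k0 iC c).

Definition is_rho (g : {rmorphism CG -> C}) (rho : {rmorphism Tring -> Tring}) :
    Prop :=
  [/\ bijective rho, forall a, rho (k0_T a) = k0_T a
    & map_mx rho (map_mx calR_T X_calR)
        = map_mx calR_T X_calR *m map_mx C_T (GZ g)].

Definition in_stab (I : set Tring) (g : {rmorphism CG -> C}) : Prop :=
  in_G g /\
  exists rho : {rmorphism Tring -> Tring},
    is_rho g rho /\ forall t, I t -> I (rho t).

(* S is the quotient of k0 (x)_D calR by I, with projection pi and the induced
   derivation dS. *)
Variables (S : comUnitRingType) (pi : {rmorphism Tring -> S}) (dS : S -> S).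

Definition is_quotient (I : set Tring) : Prop :=
  [/\ forall s, exists t, pi t = s, forall t, pi t = 0 <-> I t
    & forall t, pi (dT t) = dS (pi t)].

Definition Xbar : 'M[S]_n := map_mx pi (map_mx calR_T X_calR).

Definition in_dGal (tau : {rmorphism S -> S}) : Prop :=
  [/\ bijective tau, forall s, tau (dS s) = dS (tau s)
    & forall a, tau (pi (k0_T a)) = pi (k0_T a)].

(* m in GL_n(C) is the matrix Xbar^-1 tau(Xbar) representing tau. *)
Definition dGal_matrix (tau : {rmorphism S -> S}) (m : 'M[C]_n) : Prop :=
  m \in unitmx /\
  invmx Xbar *m map_mx tau Xbar = map_mx (fun c => pi (C_T c)) m.

(* stab(I) is the delta-Galois group of S over k0: tau |-> Xbar^-1 tau(Xbar)
   takes its values in GL_n(C), and the image of the Galois group coincides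
   with that of stab(I) under g |-> g(Z). *)
Definition stab_is_dGal (I : set Tring) : Prop :=
  (forall tau, in_dGal tau -> exists m, dGal_matrix tau m) /\
  [set GZ g | g in in_stab I] =
    [set m | exists2 tau, in_dGal tau & dGal_matrix tau m].

End PicardVessiot.

Arguments dT {DD} dD {n R iR} dR {X h} c2D _.

(* Main.v *)
From mathcomp Require Import functions.
Require Import Defs.
From HB Require Import structures.
From mathcomp Require Import all_boot all_algebra generic_quotient ring_quotient.
From mathcomp Require Import ring.
From mathcomp Require Import boolp classical_sets.

Set Implicit Arguments.
Unset Strict Implicit.
Unset Printing Implicit Defensive.

Import GRing.Theory.
Local Open Scope ring_scope.
Local Open Scope classical_set_scope.

(** Write K for k0(x), P for the localized ring D[X, 1/det X], T for its
    specialization k0 (x)_D P, and S = T/I.  The Galois group of S is contained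
    in the stabilizer of I because automorphisms of S can be lifted to the ring
    P, that is, to the situation before specialization; the carrier of the lift
    is the self-product Q = P (x)_D P.

    The first ingredient is that passing to the small base ring D loses
    nothing.  D has no nontrivial sigma-delta-ideal: a polynomial of least
    degree in such an ideal is invariant under x |-> x + 1, hence lies in the
    coefficient domain, which is delta-simple ([D_trivial]).  Clearing
    denominators, P inherits this from R ([P_trivial]).  Moreover Q is spanned
    over P by constants, the entries of Z = X^-1 (x) X and of its inverse
    generating it ([spanned_by_constants]).  In a ring spanned by constants
    over a simple one, an ideal stable under the operators and without nonzero
    constants is zero ([no_constant_ideal]).  Applied to the kernel of
    Q -> R (x)_K R, which is the D-torsion of Q, this gives injectivity
    ([base_change_inj]): a constant killed by a nonzero element of D is killed
    by a sigma-delta-ideal of D, hence by 1.  The same argument, applied to the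
    ideal of denominators of a constant of R (x)_K R, shows that this constant
    comes from Q ([const_lift]).  Thus C[G] is a ring of constants of Q.

    The second ingredient is that S has no constants besides those in C
    ([simple_constants]).  A constant of S has denominators in the coefficient
    domain that form a delta-ideal, so it lies in a subring S0 of S that is
    finitely generated over C.  This S0 is a domain, since delta-simple rings
    of characteristic 0 are ([simple_domain]), so it has a point in C
    ([point_of_generated]), and a nonzero constant s - s(point) would be
    invertible in S0 while vanishing at the point.

    Now let tau be a delta-automorphism of S over k0.  The matrix
    m = Xbar^-1 tau(Xbar) consists of constants, so it has entries in C
    ([automorphism_matrix]).  The map a (x) b |-> abar tau(bbar) from Q to S
    sends constants to constants; restricted to C[G] it is a point g of G with
    g(Z) = m.  Replacing each constant of Q by its value in C also defines a
    retraction Q -> P: the obstruction to its being well defined is a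
    sigma-delta-ideal of P which maps to 0 in S, hence does not contain 1,
    hence is zero ([retraction_exists]).  Composed with b |-> 1 (x) b, this
    retraction is a D-endomorphism of P that sends X to X m and induces tau
    ([torsor_point]); tensored with k0 it is rho_g, it induces tau on S and so
    preserves I ([lift_automorphism]).  It is bijective because tau^-1 lifts as
    well.  Conversely a rho_g that preserves I commutes with delta, since
    delta(X) = B X and g(Z) is constant, and it induces an automorphism of the
    simple ring S ([stabilizer_automorphism]). *)

(** * Ring homomorphisms, generated subrings, derivations *)

Lemma rmorphism_of_fun (A B : pzRingType) (f : A -> B) :
  {morph f : x y / x + y} -> {morph f : x y / x * y} -> f 1 = 1 ->
  exists g : {rmorphism A -> B}, (g : A -> B) = f.
Proof.
move=> fD fM f1.
have f0 : f 0 = 0 by apply: (addrI (f 0)); rewrite -fD !addr0.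
have fB : {morph f : x y / x - y}.
  move=> x y /=; apply/eqP; rewrite eq_sym subr_eq -fD subrK //.
pose fA := GRing.isZmodMorphism.Build A B f fB.
pose fMu := GRing.isMonoidMorphism.Build A B f (f1, fM).
pose g : {rmorphism A -> B} := HB.pack_for {rmorphism A -> B} f fA fMu.
by exists g.
Qed.

Lemma gen_subring_ind (R : comPzRingType) (gens : set R) (P : R -> Prop) :
  P 1 -> (forall a b, P a -> P b -> P (a - b)) ->
  (forall a b, P a -> P b -> P (a * b)) -> (forall a, gens a -> P a) ->
  forall a, a \in gen_subring gens -> P a.
Proof.
move=> P1 PB PM Pg a /asboolP /(_ (fun x => `[< P x >])) aP.
apply/asboolP; apply: aP; last by move=> b /Pg /asboolP.
split; first exact/asboolP.
  by move=> x y /asboolP Px /asboolP Py; apply/asboolP/PB.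
by move=> x y /asboolP Px /asboolP Py; apply/asboolP/PM.
Qed.

(** The operators of a subring are given as bare functions; their algebraic
    laws come from the ambient ring. *)
Lemma restricted_rmorph (A B : pzRingType) (j : {rmorphism A -> B})
    (sB : {rmorphism B -> B}) (sA : A -> A) :
  injective j -> (forall a, j (sA a) = sB (j a)) ->
  exists s : {rmorphism A -> A}, s = sA :> (A -> A).
Proof.
move=> j_inj js; apply: rmorphism_of_fun.
- by move=> x y; apply: j_inj; rewrite js !rmorphD !js.
- by move=> x y; apply: j_inj; rewrite js !rmorphM !js.
- by apply: j_inj; rewrite js !rmorph1.
Qed.

HB.instance Definition _ (R : comPzRingType) (gens : set R) :=
  GRing.isSubringClosed.Build R (gen_subring gens) (gen_subring_closed gens).

Section Derivation.
Variables (R : comPzRingType) (d : R -> R).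
Hypothesis dd : derivation d.

Lemma derD a b : d (a + b) = d a + d b. Proof. exact: dd.1. Qed.
Lemma derM a b : d (a * b) = d a * b + a * d b. Proof. exact: dd.2. Qed.
Lemma der0 : d 0 = 0. Proof. by apply: (addrI (d 0)); rewrite -derD !addr0. Qed.
Lemma derN a : d (- a) = - d a.
Proof. by apply/eqP; rewrite -addr_eq0 -derD addNr der0. Qed.
Lemma derB a b : d (a - b) = d a - d b. Proof. by rewrite derD derN. Qed.
Lemma der1 : d 1 = 0.
Proof. by apply: (addrI (d 1)); rewrite addr0 -{3}(mulr1 1) derM mul1r mulr1. Qed.

Lemma der_sum I (r : seq I) (F : I -> R) :
  d (\sum_(i <- r) F i) = \sum_(i <- r) d (F i).
Proof. exact: (big_morph d derD der0). Qed.

Lemma derX a n : d (a ^+ n.+1) = a ^+ n * d a *+ n.+1.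
Proof.
elim: n => [|n IH]; first by rewrite expr1 expr0 mul1r.
rewrite exprS derM IH [RHS]mulrS exprS -mulrnAr; ring.
Qed.

Lemma derXx a n : d (a ^+ n) * a = a ^+ n * d a *+ n.
Proof.
case: n => [|n]; first by rewrite expr0 der1 mul0r.
by rewrite derX mulrnAl mulrAC -exprSr.
Qed.

Lemma der_inv a b : a * b = 1 -> d b = - (b ^+ 2 * d a).
Proof.
move=> ab; have : b * d (a * b) = 0 by rewrite ab der1 mulr0.
rewrite derM mulrDr mulrA [b * (a * _)]mulrA [b * a]mulrC ab mul1r => /eqP.
by rewrite addrC addr_eq0 => /eqP ->; congr (- _); ring.
Qed.

Lemma der_mulmx m n p (M : 'M[R]_(m, n)) (N : 'M_(n, p)) :
  map_mx d (M *m N) = map_mx d M *m N + M *m map_mx d N.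
Proof.
apply/matrixP => i j; rewrite !mxE der_sum -big_split; apply: eq_bigr => l _ /=.
by rewrite derM !mxE.
Qed.

Lemma der_invmx n (M N W : 'M[R]_n) : M *m N = 1%:M -> N *m M = 1%:M ->
  map_mx d M = W *m M -> map_mx d N = - (N *m W).
Proof.
move=> MN NM dM.
have : map_mx d (M *m N) = 0.
  rewrite MN; apply/matrixP => i j; rewrite !mxE.
  by case: (i == j); rewrite ?der0 ?der1.
rewrite der_mulmx dM -mulmxA MN mulmx1 => /(congr1 (mulmx N)).
rewrite mulmxDr mulmxA NM mul1mx mulmx0 addrC => /eqP.
by rewrite addr_eq0 => /eqP.
Qed.

End Derivation.

Lemma restricted_derivation (A B : comPzRingType) (j : {rmorphism A -> B})
    (dB : B -> B) (dA : A -> A) :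
  injective j -> derivation dB -> (forall a, j (dA a) = dB (j a)) -> derivation dA.
Proof.
move=> j_inj dd jd; split=> a b; apply: j_inj; rewrite jd.
  by rewrite !rmorphD (derD dd) !jd.
by rewrite rmorphM (derM dd) rmorphD !rmorphM !jd.
Qed.

Lemma val_restrict (R : comPzRingType) (gens : set R) (s : R -> R) :
  (forall r, r \in gen_subring gens -> s r \in gen_subring gens) ->
  forall a : adjoin gens, val (restrict s a) = s (val a).
Proof. by move=> st a; rewrite /restrict insubdK //; apply: st; apply: valP. Qed.

(** * Points of finitely generated algebras *)

Section Nullstellensatz.
Variables (C : closedFieldType) (L : fieldType).

Section Step.
Variables (A : comNzRingType) (f : {rmorphism A -> L}) (y : L).
Local Notation "p ^f" := (map_poly f p) : ring_scope.

(** [f] need not be injective, so the degree of a polynomial over [A] may drop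
    in [L]; discarding the coefficients killed by [f] at the top makes both
    degrees agree, which Euclidean division over [A] requires. *)
Lemma image_truncation (p : {poly A}) : exists q : {poly A},
  [/\ q^f = p^f, size q = size q^f & p^f != 0 -> f (lead_coef q) != 0].
Proof.
pose q := \poly_(i < size p^f) p`_i.
have qE : q^f = p^f.
  apply/polyP => i; rewrite !coef_map coef_poly /=.
  case: ltnP => // le; rewrite rmorph0.
  by move: (coef_map f p i) => /= <-; rewrite nth_default.
have sq : size q = size q^f.
  apply/eqP; rewrite eqn_leq; apply/andP; split; rewrite ?size_poly //.
    by rewrite qE size_poly.
exists q; split=> // p0; rewrite lead_coefE sq.
have := coef_map f q (size q^f).-1; rewrite /= => <-.
by rewrite -lead_coefE lead_coef_eq0 qE.
Qed.

Lemma min_image_size (P : {poly A} -> Prop) : (exists p, P p) ->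
  exists2 p, P p & forall q, P q -> (size p^f <= size q^f)%N.
Proof.
case=> p0 Pp0.
have ex : exists m, `[< exists2 p, P p & size p^f = m >].
  by exists (size p0^f); apply/asboolP; exists p0.
have [m /asboolP [p Pp sp] mmin] := find_ex_minn ex.
exists p => // q Pq; rewrite sp; apply: mmin; apply/asboolP; exists q => //.
Qed.

(** Over the field [L], a polynomial that does not vanish at [y] is coprime to
    the minimal polynomial of [y].  The Bezout relation is obtained over [A],
    up to the kernel of [f], from an element of least degree in the ideal
    generated by [b] and [F]. *)
Lemma nonroot_divides_constant (F b : {poly A}) : F^f != 0 -> F^f.[y] = 0 ->
  (forall q : {poly A}, q^f != 0 -> q^f.[y] = 0 -> (size F^f <= size q^f)%N) ->
  b^f.[y] != 0 ->
  exists a, f a != 0 /\ exists U V W : {poly A},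
    a%:P = U * b + V * F + W /\ W^f = 0.
Proof.
move=> F0 Fy Fmin by0.
pose J (H : {poly A}) := H^f != 0 /\ exists U V W : {poly A},
    H = U * b + V * F + W /\ W^f = 0.
have Jb : J b.
  split; first by apply: contraNneq by0 => ->; rewrite horner0.
  by exists 1, 0, 0; rewrite mul1r mul0r !addr0 rmorph0.
have [H0 [H0n [U0 [V0 [W0 [H0E W00]]]]] H0min] := min_image_size (ex_intro J b Jb).
have [H [HE sH lH]] := image_truncation H0; move/(_ H0n): lH => lH.
have red (p : {poly A}) : (exists U V W : {poly A},
    p = U * b + V * F + W /\ W^f = 0) ->
    exists Q : {poly A}, exists2 l, l != 0 & l *: p^f = Q^f * H^f.
  case=> U [V [W [pE W0e]]].
  exists (Pdiv.Ring.rdivp p H), (f (lead_coef H) ^+ Pdiv.Ring.rscalp p H).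
    exact: expf_neq0.
  have := Pdiv.ComRing.rdivp_eq H p; set Q := Pdiv.Ring.rdivp p H.
  set R := Pdiv.Ring.rmodp p H; set k := Pdiv.Ring.rscalp p H => E.
  have R0 : R^f = 0.
    apply/eqP; apply: contraT => Rn.
    have sR : (size R^f < size H0^f)%N.
      rewrite -HE -sH; apply: leq_ltn_trans (size_poly _ _) _.
      apply: Pdiv.Ring.ltn_rmodpN0; apply: contraNneq lH => ->.
      by rewrite lead_coef0 rmorph0.
    move: sR; rewrite ltnNge H0min //; split=> //.
    pose c := lead_coef H ^+ k.
    (* the cofactors of the remainder R = c p - Q H *)
    exists (c%:P * U - Q * U0), (c%:P * V - Q * V0),
      (c%:P * W - Q * (W0 + (H - H0))); split; last first.
      by rewrite rmorphB !rmorphM /= rmorphD rmorphB /= W0e W00 HE subrr addr0 !mulr0 subrr.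
    have -> : R = c *: p - Q * H by rewrite /c E addrC addKr.
    rewrite -mul_polyC pE -[H in LHS](subrK H0) {2}H0E !mulrDr !mulrDl !mulNr.
    by ring.
  by rewrite -rmorphXn -map_polyZ E [LHS]rmorphD /= R0 addr0 rmorphM.
have Hy : H^f.[y] != 0.
  have [|Q [l l0 /(congr1 (fun p : {poly L} => p.[y]))]] := red b.
    by exists 1, 0, 0; rewrite mul1r mul0r !addr0 rmorph0.
  rewrite hornerZ hornerM => E; apply: contraNneq by0 => H0y.
  by move/eqP: E; rewrite H0y mulr0 mulf_eq0 (negbTE l0).
have [|Q [l l0 EF]] := red F.
  by exists 0, 1, 0; rewrite mul1r mul0r add0r addr0 rmorph0.
have lF : l *: F^f != 0 by rewrite scaler_eq0 negb_or l0.
have [Qn Hn] : Q^f != 0 /\ H^f != 0.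
  by apply/andP; rewrite -negb_or -mulf_eq0 -EF.
have Qy : Q^f.[y] = 0.
  move/(congr1 (fun p : {poly L} => p.[y])): EF; rewrite hornerZ hornerM Fy mulr0.
  by move/esym/eqP; rewrite mulf_eq0 (negbTE Hy) orbF => /eqP.
have sHf : size H^f = 1%N.
  apply/eqP; rewrite eqn_leq size_poly_gt0 Hn andbT.
  have := Fmin Q Qn Qy; rewrite -(size_scale F^f l0) EF size_mul //.
  have := Qn; rewrite -size_poly_gt0; move: (size Q^f) (size H^f) => [//|u] [|v] // _.
  by rewrite addnS /= -[X in (_ <= X -> _)%N]addn0 leq_add2l.
(* H has degree 0, so it is the constant looked for *)
exists (lead_coef H); split=> //.
exists U0, V0, (W0 + (H - H0)); split; last first.
  by rewrite rmorphD rmorphB /= HE W00 subrr addr0.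
have /size1_polyC HC : (size H <= 1)%N by rewrite sH sHf.
rewrite {1}HC lead_coefC -HC -[H in LHS](subrK H0) {2}H0E; ring.
Qed.

(** A point of [A] extends to [A[y]], with [b] nonzero at the new point, unless
    the given point is a zero of some fixed [a].  If [y] is transcendental
    over [A], any [c] will do that is not a root of the image of [b].  If [y]
    is algebraic, [c] has to be a root of the image of the minimal polynomial
    [F] of [y]; pseudo-division by [F] shows that such a [c] is consistent,
    and the Bezout relation keeps [b] nonzero. *)
Lemma extend_point_step (b : {poly A}) : b^f.[y] != 0 ->
  exists2 a, f a != 0 & forall g : {rmorphism A -> C},
    (forall x, f x = 0 -> g x = 0) -> g a != 0 ->
    exists2 c, (map_poly g b).[c] != 0 &
      forall q : {poly A}, q^f.[y] = 0 -> (map_poly g q).[c] = 0.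
Proof.
move=> by0.
have map0 (g : {rmorphism A -> C}) (q : {poly A}) :
    (forall x, f x = 0 -> g x = 0) -> q^f = 0 -> map_poly g q = 0.
  move=> gf q0; apply/polyP => i; rewrite coef_map coef0 /=; apply: gf.
  by have := coef_map f q i; rewrite q0 coef0.
have [[F0 [F0n F0y]]|trans] :=
  pselect (exists q : {poly A}, q^f != 0 /\ q^f.[y] = 0).
  have [F1 [F1n F1y] F1min] := min_image_size
    (ex_intro (fun q : {poly A} => q^f != 0 /\ q^f.[y] = 0) F0 (conj F0n F0y)).
  have [F [FE sF lF]] := image_truncation F1; move/(_ F1n): lF => lF.
  rewrite -FE in F1n F1y F1min.
  have [|a [a0 [U [V [W [aE W0]]]]]] := nonroot_divides_constant F1n F1y _ by0.
    by move=> q q0 qy; apply: F1min.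
  exists (lead_coef F * a); first by rewrite rmorphM mulf_neq0.
  move=> g gf; rewrite rmorphM mulf_eq0 negb_or => /andP [gl ga].
  have sg : size (map_poly g F) = size F.
    exact: size_map_poly_id0.
  have [|c /rootP cF] := closed_rootP (map_poly g F) _.
    rewrite sg sF; apply/eqP => /eqP/size_poly1P [e e0 E].
    by move: F1y e0; rewrite E hornerC => ->; rewrite eqxx.
  have cq (q : {poly A}) : q^f.[y] = 0 -> (map_poly g q).[c] = 0.
    move=> qy; have := Pdiv.ComRing.rdivp_eq F q.
    set Q := Pdiv.Ring.rdivp q F; set R := Pdiv.Ring.rmodp q F => E.
    have R0 : R^f = 0.
      apply/eqP; apply: contraT => Rn.
      have sR : (size R^f < size F^f)%N.
        rewrite -sF; apply: leq_ltn_trans (size_poly _ _) _.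
        apply: Pdiv.Ring.ltn_rmodpN0; apply: contraNneq lF => ->.
        by rewrite lead_coef0 rmorph0.
      move: sR; rewrite ltnNge F1min //; split=> //.
      move/(congr1 (fun p : {poly A} => p^f.[y])): E.
      rewrite map_polyZ hornerZ qy mulr0 rmorphD rmorphM hornerD hornerM F1y.
      by rewrite mulr0 add0r.
    move/(congr1 (fun p : {poly A} => (map_poly g p).[c])): E.
    rewrite map_polyZ hornerZ rmorphD rmorphM /= hornerD hornerM cF mulr0 add0r.
    rewrite (map0 g R) // horner0 rmorphXn => /eqP.
    by rewrite mulf_eq0 expf_eq0 (negbTE gl) andbF => /eqP.
  exists c => //; apply: contraNneq ga => bc.
  move/(congr1 (fun p : {poly A} => (map_poly g p).[c])): aE.
  rewrite map_polyC hornerC /= => ->; rewrite !rmorphD !rmorphM !hornerD !hornerM /=.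
  by rewrite bc cF (map0 g W) // horner0 !mulr0 !addr0.
have tr (q : {poly A}) : q^f.[y] = 0 -> q^f = 0.
  by move=> qy; apply/eqP; apply: contraT => qn; case: trans; exists q.
have bn : b^f != 0 by apply: contraNneq by0 => ->; rewrite horner0.
have [b1 [b1E _ lb]] := image_truncation b; move/(_ bn): lb => lb.
exists (lead_coef b1) => // g gf ga.
have : map_poly g b1 != 0.
  by apply: contraNneq ga => /(congr1 (fun p : {poly C} => p`_(size b1).-1));
    rewrite coef_map coef0 /= -lead_coefE => ->.
case/closed_nonrootP => c; rewrite /root => cb; exists c.
  have := map0 g (b - b1) gf; rewrite !rmorphB /= b1E subrr => /(_ erefl)/eqP.
  by rewrite subr_eq0 => /eqP ->.
by move=> q /tr /(map0 g q gf) ->; rewrite horner0.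
Qed.

End Step.

(** The ring generated by the image of [A] and by [ys] is represented by the
    iterated polynomial ring [B] over [A] with its evaluation map to [L]: a
    point of that subring of [L] is a point of [B] whose kernel contains that
    of the evaluation. *)
Lemma extend_point (ys : seq L) (A : comNzRingType) (f : {rmorphism A -> L}) :
  exists2 a, f a != 0 & forall g : {rmorphism A -> C},
    (forall x, f x = 0 -> g x = 0) -> g a != 0 ->
    exists (B : comNzRingType) (f' : {rmorphism B -> L})
      (g' : {rmorphism B -> C}) (i : A -> B),
    [/\ forall x, f' (i x) = f x, forall x, g' (i x) = g x,
        {in ys, forall y, exists x, f' x = y}
      & forall x, f' x = 0 -> g' x = 0].
Proof.
elim: ys A f => [|y ys IH] A f.
  by exists 1; rewrite ?rmorph1 ?oner_neq0 // => g gf _; exists A, f, g, id.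
pose f1 : {rmorphism {poly A} -> L} := horner_eval y \o map_poly f.
have [b b0 IHb] := IH _ f1; have [a a0 aP] := extend_point_step b0.
exists a => // g gf /(aP g gf) [c cb cP].
pose g1 : {rmorphism {poly A} -> C} := horner_eval c \o map_poly g.
have [//|//|B [f' [g' [i [fi gi ysP fg]]]]] := IHb g1.
exists B, f', g', (fun x => i x%:P); split=> //.
- by move=> x; rewrite fi /f1 /= map_polyC /horner_eval hornerC.
- by move=> x; rewrite gi /g1 /= map_polyC /horner_eval hornerC.
- move=> z; rewrite inE => /predU1P [->|/ysP //].
  by exists (i 'X); rewrite fi /f1 /= map_polyX /horner_eval hornerX.
Qed.

(** The weak Nullstellensatz for a C-algebra generated by [ys] inside a field:
    the relation between [f] and [g] is a C-algebra morphism from that algebra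
    to C. *)
Lemma point_of_generated (k : {rmorphism C -> L}) (ys : seq L) :
  exists (B : comNzRingType) (f : {rmorphism B -> L}) (g : {rmorphism B -> C}),
    [/\ forall x, f x = 0 -> g x = 0,
        forall c, exists2 x, f x = k c & g x = c
      & forall w, w \in gen_subring (range k `|` [set` ys]) ->
          exists x, f x = w].
Proof.
have [a a0 /(_ idfun)] := extend_point ys k; case.
- by move=> x /eqP; rewrite fmorph_eq0 => /eqP.
- by apply: contraNneq a0 => /= ->; rewrite rmorph0.
move=> B [f [g [i [fi gi ysP fg]]]]; exists B, f, g; split=> // [c|w].
  by exists (i c); rewrite ?fi ?gi.
apply: (@gen_subring_ind _ _ (fun w => exists x, f x = w)).
- by exists 1; rewrite rmorph1.
- by move=> _ _ [x <-] [x' <-]; exists (x - x'); rewrite rmorphB.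
- by move=> _ _ [x <-] [x' <-]; exists (x * x'); rewrite rmorphM.
- by move=> v [[c _ <-]|/ysP //]; exists (i c).
Qed.

End Nullstellensatz.

(** * Differentially simple rings *)

Section SimpleDomain.
Variables (R : comPzRingType) (d : R -> R).
Hypotheses (dd : derivation d) (ds : d_simple d).
Hypothesis char0 : forall n, exists u : R, n.+1%:R * u = 1.

(** From a^n = 0, repeated differentiation gives a^(n-k) (d a)^(2k) = 0 for
    every k up to n. *)
Lemma nilpotent_der a n : a ^+ n = 0 -> exists m, d a ^+ m = 0.
Proof.
move=> an.
suff H k j : (k + j)%N = n -> a ^+ j * d a ^+ k.*2 = 0.
  by exists n.*2; rewrite -[LHS]mul1r -(expr0 a) H ?addn0.
elim: k j => [|k IH] j kj; first by rewrite -{1}kj in an; rewrite an mul0r.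
have := IH j.+1; rewrite addnS -addSn kj => /(_ erefl) E.
(* differentiate E and multiply by d a: the second term is then a multiple of E *)
have D : d (d a ^+ k.*2) * d a = d a ^+ k.*2 * (d (d a) * k.*2%:R).
  by rewrite derXx // -mulr_natr mulrA.
have : d (a ^+ j.+1 * d a ^+ k.*2) * d a = 0 by rewrite E der0 // mul0r.
rewrite derM // mulrDl -(mulrA (a ^+ j.+1)) D mulrA E mul0r addr0 derX //.
have [u u1] := char0 j; rewrite -mulr_natr => /(congr1 ( *%R u)).
rewrite mulr0 => E0; rewrite doubleS !exprS.
transitivity (j.+1%:R * u * (a ^+ j * (d a * (d a * d a ^+ k.*2)))).
  by rewrite u1 mul1r.
by rewrite -[RHS]E0; ring.
Qed.

Lemma nilpotent0 (a : R) n : a ^+ n = 0 -> a = 0.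
Proof.
move=> an.
(* the nilradical is a d-ideal *)
pose N : set R := [set x | exists m, x ^+ m = 0].
have [_ /(_ N)] := ds; case.
- split; last by move=> x [m /nilpotent_der].
  split; first by exists 1%N; rewrite expr1.
    move=> x y [m xm] [p yp]; exists (m + p)%N; rewrite exprDn big1 // => i _.
    have [pi|ip] := leqP p i.
      by rewrite -(subnK pi) exprD yp mulr0 mulr0 mul0rn.
    suff mi : (m <= m + p - i)%N by rewrite -(subnK mi) exprD xm mulr0 mul0r mul0rn.
    by rewrite -addnBA ?leq_addr // ltnW.
  by move=> r x [m xm]; exists m; rewrite exprMn xm mulr0.
- by move=> NE; have : N a by [exists n]; rewrite NE.
- move=> NE; have [m] : N 1 by rewrite NE.
  by rewrite expr1n => /eqP; rewrite (negbTE ds.1).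
Qed.

(** The annihilator of the powers of a non-nilpotent [a] is a d-ideal that
    does not contain 1. *)
Lemma simple_domain (a b : R) : a * b = 0 -> a = 0 \/ b = 0.
Proof.
move=> ab; have [->|/eqP a0] := eqVneq a 0; [by left|right].
pose K : set R := [set x | exists m, a ^+ m * x = 0].
have [_ /(_ K)] := ds; case.
- split.
    split; first by exists 0%N; rewrite mulr0.
      move=> x y [m xm] [p yp]; exists (m + p)%N; rewrite exprD mulrDr.
      by rewrite mulrAC xm mul0r -mulrA yp mulr0 addr0.
    by move=> r x [m xm]; exists m; rewrite mulrCA xm mulr0.
  move=> x [m xm]; exists m.+1.
  have := congr1 (fun z => d z * a) xm; rewrite der0 // mul0r derM // mulrDl.
  rewrite mulrAC derXx // mulrnAl mulrAC xm mul0r mul0rn add0r.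
  by rewrite exprSr mulrAC.
- by move=> KE; have : K b by [exists 1%N; rewrite expr1]; rewrite KE.
- move=> KE; have [m] : K 1 by rewrite KE.
  by rewrite mulr1 => /nilpotent0.
Qed.

End SimpleDomain.

(** * Derivations on fields of fractions *)

Section Fraction.

(** Here [da] stands for the derivative of [a], and similarly for the other
    letters. *)
Lemma quotient_rules (F : fieldType) (a b c e da db dc de : F) :
  b != 0 -> e != 0 ->
  ((da * e + a * de + (dc * b + c * db)) * (b * e)
     - (a * e + c * b) * (db * e + b * de)) / (b * e) ^+ 2 =
  (da * b - a * db) / b ^+ 2 + (dc * e - c * de) / e ^+ 2 /\
  ((da * c + a * dc) * (b * e) - a * c * (db * e + b * de)) / (b * e) ^+ 2 =
  (da * b - a * db) / b ^+ 2 * (c / e) + a / b * ((dc * e - c * de) / e ^+ 2).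
Proof. by move=> b0 e0; split; field; rewrite b0 e0. Qed.

Variable E : idomainType.

Lemma frac_repr (q : {fraction E}) :
  q = tofrac \n_(repr q) / tofrac \d_(repr q).
Proof.
rewrite -{1}[q]reprK -{1}[repr q]Ratio_numden; unlock FracField.tofrac.
rewrite -[X in _ * X]FracField.pi_inv -[RHS]FracField.pi_mul.
rewrite /FracField.mulf /FracField.invf /=.
by rewrite !(numer_Ratio, denom_Ratio) ?oner_neq0 ?mulr1 ?mul1r ?denom_ratioP.
Qed.

Variable d : E -> E.
Hypothesis dd : derivation d.

Lemma frac_derE (a b : E) : b != 0 ->
  frac_der d (tofrac a / tofrac b) = tofrac (d a * b - a * d b) / tofrac b ^+ 2.
Proof.
move=> b0; rewrite /frac_der; set q := tofrac a / _.
set n := \n_(repr q); set m := \d_(repr q).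
have m0 : m != 0 by exact: denom_ratioP.
have [tb tm] : (tofrac b : {fraction E}) != 0 /\ (tofrac m : {fraction E}) != 0.
  by rewrite !tofrac_eq0.
have nm : n * b = a * m.
  have /eqP := frac_repr q; rewrite -/n -/m {1}/q eqr_div //; rewrite -!tofracM tofrac_eq.
  by move/eqP.
apply: (mulIf (expf_neq0 2 tb)); apply: (mulIf (expf_neq0 2 tm)).
rewrite [X in _ = X * _]mulfVK ?expf_neq0 // mulrAC mulfVK ?expf_neq0 //.
rewrite -!tofracXn -!tofracM; congr (tofrac _).
have := congr1 d nm; rewrite !(derM dd) => dnm.
have -> : (d n * m - n * d m) * b ^+ 2 =
  (d n * b + n * d b) * (m * b) - n * b * (d b * m + d m * b) by ring.
rewrite dnm nm; ring.
Qed.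

Lemma frac_der_tofrac a : frac_der d (tofrac a) = tofrac (d a).
Proof.
have /frac_derE := oner_neq0 E => /(_ a).
by rewrite !tofrac1 invr1 !mulr1 (der1 dd) mulr0 subr0 expr1n invr1 mulr1.
Qed.

Lemma frac_der_derivation : derivation (frac_der d).
Proof.
suff H x y : frac_der d (x + y) = frac_der d x + frac_der d y /\
             frac_der d (x * y) = frac_der d x * y + x * frac_der d y.
  by split=> x y; case: (H x y).
rewrite (frac_repr x) (frac_repr y).
set a := \n_(repr x); set b := \d_(repr x).
set c := \n_(repr y); set e := \d_(repr y).
have [b0 e0] : b != 0 /\ e != 0 by rewrite !denom_ratioP.
have [tb te] : (tofrac b : {fraction E}) != 0 /\ (tofrac e : {fraction E}) != 0.
  by rewrite !tofrac_eq0.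
have be : b * e != 0 by rewrite mulf_neq0.
have -> : tofrac a / tofrac b + tofrac c / tofrac e =
  tofrac (a * e + c * b) / tofrac (b * e) :> {fraction E}.
  by rewrite tofracD !tofracM addf_div.
have -> : tofrac a / tofrac b * (tofrac c / tofrac e) =
  tofrac (a * c) / tofrac (b * e) :> {fraction E}.
  by rewrite !tofracM mulf_div.
rewrite !frac_derE // !(derD dd, derM dd) !(tofracD, tofracN, tofracM).
exact: quotient_rules.
Qed.

End Fraction.

(** * Constants of a simple ring over k0 *)

Lemma common_denom (E : idomainType) (s : seq {fraction E}) :
  exists2 d : E, d != 0 & {in s, forall q, exists a, tofrac d * q = tofrac a}.
Proof.
elim: s => [|q s [d d0 dP]]; first by exists 1; rewrite ?oner_neq0.
exists (d * \d_(repr q)); first by rewrite mulf_neq0 ?denom_ratioP.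
move=> r; rewrite inE => /predU1P [->|/dP [a ra]]; rewrite tofracM.
  exists (d * \n_(repr q)); rewrite {2}(frac_repr q) tofracM -mulrA; congr (_ * _).
  by rewrite mulrCA mulfV ?mulr1 // tofrac_eq0 denom_ratioP.
by exists (a * \d_(repr q)); rewrite mulrAC ra tofracM.
Qed.

Section Constants.
Variables (C : closedFieldType) (DD : idomainType).
Variables (iC : {rmorphism C -> DD}) (dD : DD -> DD).
Hypothesis hbase : base_hyp iC dD.
Variables (S : comUnitRingType) (dS : S -> S) (k : {rmorphism k0 DD -> S}).
Hypotheses (dSd : derivation dS) (Ssimple : d_simple dS).
Hypothesis dk : forall a, dS (k a) = k (dk0 dD a).
Variables (n : nat) (X Y : 'M[S]_n) (B : 'M[k0 DD]_n).
Hypotheses (XY : X *m Y = 1%:M) (YX : Y *m X = 1%:M).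
Hypothesis dX : map_mx dS X = map_mx k B *m X.
Hypothesis gen_S : forall s, s \in gen_subring
  (range k `|` [set s | exists i j, s = X i j \/ s = Y i j]).

Let kD : {rmorphism DD -> S} := k \o @tofrac DD.
Let kC : {rmorphism C -> S} := kD \o iC.

Lemma char0_inv m : exists u : S, m.+1%:R * u = 1.
Proof.
exists (kC m.+1%:R^-1); rewrite -(rmorph_nat kC) -rmorphM mulfV ?rmorph1 //.
case: hbase => pC _ _ _ _; move/pcharf0P: pC => ->. by [].
Qed.

Lemma dkD a : dS (kD a) = kD (dD a).
Proof.
by rewrite /kD /= dk /dk0 frac_der_tofrac //; case: hbase.
Qed.

Lemma kC_const c : dS (kC c) = 0.
Proof.
case: hbase => _ _ _ dC _; rewrite /kC /= -[k _]/(kD (iC c)) dkD.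
by have /dC -> : exists c', iC c = iC c' by [exists c]; rewrite rmorph0.
Qed.

(** The ideal generated by a constant is stable under [dS]. *)
Lemma const_inv u : dS u = 0 -> u != 0 -> exists2 v, u * v = 1 & dS v = 0.
Proof.
move=> du u0; pose J : set S := [set x | exists r, x = u * r].
have Ju : J u by exists 1; rewrite mulr1.
have [_ /(_ J)] := Ssimple; case.
- split; first split.
  + by exists 0; rewrite mulr0.
  + by move=> _ _ [a ->] [b ->]; exists (a + b); rewrite mulrDr.
  + by move=> r _ [a ->]; exists (r * a); rewrite mulrCA.
  + by move=> _ [a ->]; exists (dS a); rewrite (derM dSd) du mul0r add0r.
- by move=> JE; move: Ju u0; rewrite JE => ->; rewrite eqxx.
- move=> JE; have [v v1] : J 1 by rewrite JE.
  by exists v => //; rewrite (der_inv dSd (esym v1)) du mulr0 oppr0.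
Qed.

(** The subring [P] below is finitely generated over C, stable under [dS], and
    contains all constants of [S], since the denominators of a constant form a
    d-ideal of [DD].  A point of [P] over C has to be injective on the field
    of constants, which is therefore C. *)
Lemma simple_constants s : dS s = 0 -> exists c, s = k (C_k0 iC c).
Proof.
case: hbase => pC ddD Dsimple dC [g0 g0P].
have [d d0 dP] := common_denom [seq B ij.1 ij.2 | ij : 'I_n * 'I_n].
have td : (tofrac d : k0 DD) != 0 by rewrite tofrac_eq0.
(* d is a common denominator of the entries of B: adjoining 1/d
   makes the subring stable under dS *)
pose ys : seq S := map kD g0 ++ [seq X ij.1 ij.2 | ij : 'I_n * 'I_n] ++
   [seq Y ij.1 ij.2 | ij : 'I_n * 'I_n] ++ [:: k (tofrac d)^-1].
pose P := gen_subring (range kC `|` [set` ys]).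
have Pys y : y \in ys -> y \in P by move=> yP; apply: mem_gen_subring; right.
have PkD a : kD a \in P.
  apply: (@gen_subring_ind _ _ (fun a => kD a \in P)) (g0P a).
  - by rewrite rmorph1 rpred1.
  - by move=> ? ? ? ?; rewrite rmorphB rpredB.
  - by move=> ? ? ? ?; rewrite rmorphM rpredM.
  - move=> b [[c _ <-]|bg]; first by apply: mem_gen_subring; left; exists c.
    by apply: Pys; rewrite mem_cat map_f.
have PX i j : X i j \in P.
  by apply: Pys; rewrite !mem_cat (map_f (fun ij => X ij.1 ij.2) (mem_enum _ (i, j))) ?orbT.
have PY i j : Y i j \in P.
  by apply: Pys; rewrite !mem_cat (map_f (fun ij => Y ij.1 ij.2) (mem_enum _ (i, j))) ?orbT.
have Pd : k (tofrac d)^-1 \in P by apply: Pys; rewrite !mem_cat inE eqxx ?orbT.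
have PB i j : k (B i j) \in P.
  have [|a aE] := dP (B i j).
    by rewrite (map_f (fun ij => B ij.1 ij.2) (mem_enum _ (i, j))).
  have -> : B i j = (tofrac d)^-1 * tofrac a by rewrite -aE mulKf.
  by rewrite rmorphM rpredM // PkD.
have PdX i j : dS (X i j) \in P.
  have /matrixP/(_ i j) := dX; rewrite !mxE => ->.
  by apply: rpred_sum => l _; rewrite mxE rpredM.
have PdY i j : dS (Y i j) \in P.
  have /matrixP/(_ i j) := der_invmx dSd XY YX dX; rewrite !mxE => ->.
  by rewrite rpredN; apply: rpred_sum => l _; rewrite mxE rpredM.
have PdS a : a \in P -> dS a \in P.
  move=> aP; suff: a \in P /\ dS a \in P by case.
  apply: (@gen_subring_ind _ _ (fun a => a \in P /\ dS a \in P)) aP.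
  - by rewrite (der1 dSd) rpred0 rpred1.
  - by move=> u v [? ?] [? ?]; rewrite (derB dSd) !rpredB.
  - by move=> u v [? ?] [? ?]; rewrite (derM dSd) rpredM // rpredD // rpredM.
  - move=> b bP; split; first exact: mem_gen_subring.
    case: bP => [[c _ <-]|]; first by rewrite kC_const rpred0.
    rewrite /= !mem_cat => /or4P [] /= => [/mapP[a' _ ->]|/mapP[ij _ ->]|/mapP[ij _ ->]|] //.
      by rewrite dkD PkD.
    rewrite inE => /eqP ->; rewrite (@der_inv _ _ dSd (kD d)).
      by rewrite rpredN rpredM ?rpredX // dkD PkD.
    by rewrite /kD /= -rmorphM mulfV // rmorph1.
have den s' : exists2 e, e != 0 & kD e * s' \in P.
  apply: (@gen_subring_ind _ _ (fun s' => exists2 e, e != 0 & kD e * s' \in P)) (gen_S s').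
  - by exists 1; rewrite ?oner_neq0 // mulr1 PkD.
  - move=> a b [e e0 eP] [f f0 fP]; exists (e * f); first by rewrite mulf_neq0.
    have -> : kD (e * f) * (a - b) = kD f * (kD e * a) - kD e * (kD f * b).
      by rewrite rmorphM; ring.
    by rewrite rpredB // rpredM // PkD.
  - move=> a b [e e0 eP] [f f0 fP]; exists (e * f); first by rewrite mulf_neq0.
    have -> : kD (e * f) * (a * b) = (kD e * a) * (kD f * b).
      by rewrite rmorphM; ring.
    by rewrite rpredM.
  - move=> b [[q _ <-]|[i [j [->|->]]]].
    + exists (\d_(repr q)); first by rewrite denom_ratioP.
      rewrite {2}(frac_repr q) /kD /= -rmorphM mulrCA mulfV ?mulr1 ?PkD //.
      by rewrite tofrac_eq0 denom_ratioP.
    + by exists 1; rewrite ?oner_neq0 // rmorph1 mul1r.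
    + by exists 1; rewrite ?oner_neq0 // rmorph1 mul1r.
have constP s' : dS s' = 0 -> s' \in P.
  move=> ds; pose J : set DD := [set e | kD e * s' \in P].
  have [e e0 eP] := den s'; have Je : J e by [].
  have JP x : kD x * s' \in P -> J x by [].
  have [_ /(_ J)] := Dsimple; case.
  - split; first split.
    + by apply: JP; rewrite rmorph0 mul0r rpred0.
    + by move=> a b aP bP; apply: JP; rewrite rmorphD mulrDl rpredD.
    + by move=> r a aP; apply: JP; rewrite rmorphM -mulrA rpredM // PkD.
    + move=> a /PdS; rewrite (derM dSd) ds mulr0 addr0 dkD; exact: JP.
  - by move=> JE; move: Je e0; rewrite JE => ->; rewrite eqxx.
  - move=> JE; have : J 1 by [rewrite JE]; rewrite -[J 1]/(is_true (kD 1 * s' \in P)).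
    by rewrite rmorph1 mul1r.
have integral : GRing.integral_domain_axiom S.
  move=> a b /(simple_domain dSd Ssimple char0_inv) [] ->; by rewrite eqxx ?orbT.
(* the point is taken inside the field of fractions of S *)
pose S' : idomainType := HB.pack_for idomainType S
  (GRing.ComUnitRing_isIntegral.Build S integral).
pose kL : {rmorphism C -> {fraction S'}} := @tofrac S' \o (kC : {rmorphism C -> S'}).
have [M [f [g [fg fC fP]]]] := point_of_generated kL (map (@tofrac S') ys).
have PL a : a \in P -> exists x, f x = tofrac (a : S').
  move=> aP; apply: fP.
  apply: (@gen_subring_ind _ _ (fun a => @tofrac S' a \in _)) aP.
  - by rewrite tofrac1 rpred1.
  - by move=> u v ? ?; rewrite tofracB rpredB.
  - by move=> u v ? ?; rewrite tofracM rpredM.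
  - move=> b [[c _ <-]|by_]; first by apply: mem_gen_subring; left; exists c.
    by apply: mem_gen_subring; right; rewrite /= map_f.
move=> ds; have [x xE] := PL s (constP s ds); have [y yE gy] := fC (g x).
exists (g x); apply/eqP; rewrite -subr_eq0; apply: contraT => u0.
have du : dS (s - kC (g x)) = 0 by rewrite (derB dSd) ds kC_const subrr.
(* s minus its value at the point would be a unit of P that vanishes there *)
have [v uv dv] := const_inv du u0; have [z zE] := PL v (constP v dv).
have : g ((x - y) * z - 1) = 0.
  apply: fg; rewrite rmorphB rmorphM rmorphB xE yE zE rmorph1.
  rewrite /kL /= -tofracB -tofracM -tofrac1 -tofracB.
  by have -> : (s : S') - kC (g x) = (s - kC (g x) : S) by []; rewrite uv subrr tofrac0.
rewrite rmorphB rmorphM rmorphB gy subrr mul0r rmorph1 sub0r => /eqP.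
by rewrite oppr_eq0 oner_eq0.
Qed.

End Constants.

(** * Tensor products of rings with operators *)

Section TensorRing.
Local Open Scope quotient_scope.
Variables (A : Type) (B M : comPzRingType) (f : A -> B) (g : A -> M).
Notation T := (tensor f g).

Lemma tens0l m : tens f g 0 m = 0.
Proof. by apply: (addrI (tens f g 0 m)); rewrite -tensDl !addr0. Qed.
Lemma tens0r b : tens f g b 0 = 0.
Proof. by apply: (addrI (tens f g b 0)); rewrite -tensDr !addr0. Qed.
Lemma tensBl b b' m : tens f g (b - b') m = tens f g b m - tens f g b' m.
Proof. by apply/eqP; rewrite eq_sym subr_eq -tensDl subrK. Qed.
Lemma tensBr b m m' : tens f g b (m - m') = tens f g b m - tens f g b m'.
Proof. by apply/eqP; rewrite eq_sym subr_eq -tensDr subrK. Qed.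

Lemma tensor_seqE s : \pi_(tensor f g) s = \sum_(p <- s) tens f g p.1 p.2 :> T.
Proof.
elim: s => [|[b m] s IHs]; first by rewrite big_nil.
by rewrite big_cons -IHs /GRing.add /= tensor_addE.
Qed.

Definition tensl (b : B) : T := tens f g b 1.
Definition tensr (m : M) : T := tens f g 1 m.

Fact tensl_zmod : zmod_morphism tensl.
Proof. by move=> x y; apply: tensBl. Qed.
Fact tensl_monoid : monoid_morphism tensl.
Proof. by split=> // x y; rewrite /tensl tensM mulr1. Qed.
HB.instance Definition _ := GRing.isZmodMorphism.Build B T tensl tensl_zmod.
HB.instance Definition _ := GRing.isMonoidMorphism.Build B T tensl tensl_monoid.
Fact tensr_zmod : zmod_morphism tensr.
Proof. by move=> x y; apply: tensBr. Qed.
Fact tensr_monoid : monoid_morphism tensr.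
Proof. by split=> // x y; rewrite /tensr tensM mulr1. Qed.
HB.instance Definition _ := GRing.isZmodMorphism.Build M T tensr tensr_zmod.
HB.instance Definition _ := GRing.isMonoidMorphism.Build M T tensr tensr_monoid.

Lemma tens_lr b m : tens f g b m = tensl b * tensr m.
Proof. by rewrite tensM mulr1 mul1r. Qed.

Lemma tensor_rect (P : T -> Prop) :
  (forall u v, P u -> P v -> P (u + v)) -> P 0 -> (forall b m, P (tens f g b m)) ->
  forall u, P u.
Proof.
move=> PD P0 Pt u; rewrite (tensE u).
by apply: (big_ind P) => // p _; apply: Pt.
Qed.

(** The universal property of the tensor product of algebras. *)
Lemma tensor_lift (V : comPzRingType) (p : {rmorphism B -> V})
    (q : {rmorphism M -> V}) : (forall a, p (f a) = q (g a)) ->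
  exists F : {rmorphism T -> V}, forall b m, F (tens f g b m) = p b * q m.
Proof.
move=> pq; pose phi b m := p b * q m.
have bal : balanced f g phi.
  by split=> *; rewrite /phi ?rmorphD ?mulrDl ?mulrDr // !rmorphM pq mulrCA mulrA.
pose F0 (u : T) := \sum_(x <- repr u) phi x.1 x.2.
have F0E s : F0 (\pi_(tensor f g) s) = \sum_(x <- s) phi x.1 x.2.
  exact: tensor_reprE.
have [||| F FE] := @rmorphism_of_fun T V F0.
- elim/tensor_ind=> s; elim/tensor_ind=> t.
  by rewrite {1}/GRing.add /= tensor_addE !F0E big_cat.
- elim/tensor_ind=> s; elim/tensor_ind=> t.
  rewrite {1}/GRing.mul /= tensor_mulE !F0E big_allpairs_dep mulr_suml.
  apply: eq_bigr => x _; rewrite mulr_sumr; apply: eq_bigr => y _.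
  by rewrite /phi !rmorphM /= mulrACA.
- by rewrite [LHS]F0E big_seq1 /phi !rmorph1 mulr1.
by exists F => b m; rewrite FE F0E big_seq1.
Qed.

Lemma rmorph_tensor_eq (V : comPzRingType) (F G : {rmorphism T -> V}) :
  (forall b, F (tensl b) = G (tensl b)) -> (forall m, F (tensr m) = G (tensr m)) ->
  forall u, F u = G u.
Proof.
move=> El Er; apply: tensor_rect => [u v|| b m]; rewrite ?rmorphD ?rmorph0 //.
  by move=> -> ->.
by rewrite tens_lr !rmorphM El Er.
Qed.

Section End.
Variables (sA : A -> A) (sB : {rmorphism B -> B}) (sM : {rmorphism M -> M}).
Hypotheses (sf : forall a, sB (f a) = f (sA a)) (sg : forall a, sM (g a) = g (sA a)).

Lemma tensor_endE b m : tensor_end sB sM (tens f g b m) = tens f g (sB b) (sM m).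
Proof. by rewrite (tensor_end_tens sf sg). Qed.

Lemma tensor_end_rmorph :
  exists F : {rmorphism T -> T}, F = tensor_end sB sM :> (T -> T).
Proof.
apply: rmorphism_of_fun.
- elim/tensor_ind=> s; elim/tensor_ind=> t; rewrite /GRing.add /=.
  by rewrite tensor_addE !(tensor_end_tens sf sg) tensor_addE map_cat.
- elim/tensor_ind=> s; elim/tensor_ind=> t; rewrite /GRing.mul /=.
  rewrite tensor_mulE !(tensor_end_tens sf sg) [RHS]tensor_mulE !tensor_seqE.
  rewrite big_map !big_allpairs_dep big_map; apply: eq_bigr => x _.
  by rewrite big_map; apply: eq_bigr => y _; rewrite !rmorphM.
- by rewrite [LHS]tensor_endE !rmorph1.
Qed.

End End.

Section Der.
Variables (dA : A -> A) (dB : B -> B) (dM : M -> M).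
Hypotheses (ddB : derivation dB) (ddM : derivation dM).
Hypotheses (df : forall a, dB (f a) = f (dA a)) (dg : forall a, dM (g a) = g (dA a)).

Lemma tensor_der_seqE s : tensor_der dB dM (\pi_(tensor f g) s) =
  \sum_(p <- s) (tens f g (dB p.1) p.2 + tens f g p.1 (dM p.2)).
Proof.
by rewrite (tensor_der_tens ddB ddM df dg) tensor_seqE big_cat !big_map big_split.
Qed.

Lemma tensor_derE b m : tensor_der dB dM (tens f g b m) =
   tens f g (dB b) m + tens f g b (dM m).
Proof. by rewrite tensor_der_seqE big_seq1. Qed.

Lemma tensor_der_derivation : @derivation T (tensor_der dB dM).
Proof.
split.
- elim/tensor_ind=> s; elim/tensor_ind=> t; rewrite {1}/GRing.add /=.
  by rewrite tensor_addE !tensor_der_seqE big_cat.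
- elim/tensor_ind=> s; elim/tensor_ind=> t; rewrite {1}/GRing.mul /=.
  rewrite tensor_mulE !tensor_der_seqE !tensor_seqE big_allpairs_dep !mulr_suml.
  rewrite -big_split; apply: eq_bigr => x _ /=.
  rewrite !mulr_sumr -big_split; apply: eq_bigr => y _ /=.
  rewrite (derM ddB) (derM ddM) tensDl tensDr mulrDl mulrDr !tensM.
  by rewrite addrACA.
Qed.

End Der.
End TensorRing.

(** * Torsion in a tensor product *)

Section Germs.
Local Open Scope quotient_scope.
Variables (D : comPzRingType) (V : zmodType).
Variable nz : D -> Prop.
Hypotheses (nz1 : nz 1) (nzM : forall a b, nz a -> nz b -> nz (a * b)).

Definition null_germ : {pred D -> V} := fun F =>
  `[< exists2 d, nz d & forall e, F (d * e) = 0 >].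

Lemma null_germ_closed : zmod_closed null_germ.
Proof.
split; first by apply/asboolP; exists 1.
move=> F G /asboolP [d d0 dF] /asboolP [e e0 eG]; apply/asboolP.
exists (d * e); first exact: nzM.
move=> c; rewrite -[LHS]/(F (d * e * c) - G (d * e * c)) -{1}mulrA dF.
by rewrite [d * e]mulrC -mulrA eG subrr.
Qed.

(** Functions from [D] to [V], identified when they agree on all multiples of
    some [d] with [nz d].  This is a home for fractions: [t/d] is the germ of
    [e |-> (e/d) t], which is defined on the multiples of [d]. *)
Lemma germs_exist : exists (W : zmodType) (cls : {additive (D -> V) -> W}),
  forall F, cls F = 0 <-> exists2 d, nz d & forall e, F (d * e) = 0.
Proof.
pose ngm := GRing.isZmodClosed.Build _ null_germ null_germ_closed.
pose ng : zmodClosed (D -> V) := HB.pack_for (zmodClosed (D -> V)) null_germ ngm.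
pose W := Quotient.quot ng.
exists W, (\pi_W) => F; split.
  move=> F0; have : F == 0 %[mod W] by rewrite F0 raddf0.
  by rewrite -Quotient.idealrBE subr0 => /asboolP.
move=> F0; transitivity (\pi_W (0 : D -> V)); last exact: raddf0.
by apply/eqP; rewrite -Quotient.idealrBE subr0; apply/asboolP.
Qed.

End Germs.

Section Denominators.
Local Open Scope quotient_scope.
Variables (K : fieldType) (R D P : comPzRingType).
Variables (iR : {rmorphism K -> R}) (jD : {rmorphism D -> K}).
Variables (jP : {rmorphism P -> R}) (f : {rmorphism D -> P}).
Hypotheses (jD_inj : injective jD) (jP_inj : injective jP).
Hypothesis jPf : forall u, jP (f u) = iR (jD u).
Hypothesis den_K : forall w, exists u v, v != 0 /\ w * jD v = jD u.

Lemma base_neq01 : (1 : D) != 0.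
Proof. by apply: contraTneq isT => /(congr1 jD)/eqP; rewrite rmorph1 rmorph0 oner_eq0. Qed.

Lemma base_mulf_neq0 (a b : D) : a != 0 -> b != 0 -> a * b != 0.
Proof.
rewrite -!(inj_eq jD_inj) rmorphM rmorph0; exact: mulf_neq0.
Qed.

(** The elements that have a denominator form a subring. *)
Lemma den_generated (G : set R) : (forall a, G a -> exists p, jP p = a) ->
  forall r, r \in gen_subring (range iR `|` G) ->
  exists v p, v != 0 /\ iR (jD v) * r = jP p.
Proof.
move=> GP; apply: (@gen_subring_ind _ _ (fun r => exists v p,
  v != 0 /\ iR (jD v) * r = jP p)).
- by exists 1, 1; rewrite base_neq01 !rmorph1 mulr1.
- move=> a b [v [p [v0 vp]]] [w [q [w0 wq]]].
  exists (v * w), (f w * p - f v * q); split; first exact: base_mulf_neq0.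
  by rewrite rmorphB !(rmorphM jP) !jPf -vp -wq !rmorphM /=; ring.
- move=> a b [v [p [v0 vp]]] [w [q [w0 wq]]].
  exists (v * w), (p * q); split; first exact: base_mulf_neq0.
  by rewrite (rmorphM jP) -vp -wq !rmorphM /=; ring.
- move=> _ [[w _ <-]|/GP [p <-]].
    have [u [v [v0 wv]]] := den_K w; exists v, (f u); split=> //.
    by rewrite jPf -wv rmorphM mulrC.
  by exists 1, p; rewrite base_neq01 !rmorph1 mul1r.
Qed.

Hypothesis den_R : forall r, exists v p, v != 0 /\ iR (jD v) * r = jP p.

Notation Q := (tensor f f).
Notation RR := (tensor iR iR).

Lemma base_change : exists F : {rmorphism Q -> RR},
  forall a b, F (tens f f a b) = tens iR iR (jP a) (jP b).
Proof.
have [|F FE] := @tensor_lift D P P f f RR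
  (@tensl _ _ _ iR iR \o jP) (@tensr _ _ _ iR iR \o jP).
  by move=> a; rewrite /= jPf; have := tens_bal iR iR (jD a) 1 1; rewrite !mulr1.
by exists F => a b; rewrite FE /= -tens_lr.
Qed.

(** Germs only see the multiples [e] of a denominator of [r], so the default
    value 0 is harmless. *)
Definition cleared (e : D) (r : R) : P := xget 0 [set p | jP p = iR (jD e) * r].

Lemma clearedE e r p : iR (jD e) * r = jP p -> cleared e r = p.
Proof. by move=> rp; apply: xget_unique => // q /=; rewrite rp => /jP_inj. Qed.

(** An element of the tensor product over [K] vanishes only if every balanced
    map kills it.  The balanced map used here sends [(r, r')] to the germ of
    [e |-> (e r) (x) (e r')], which has values in [Q]. *)
Lemma base_change_torsion (F : {rmorphism Q -> RR}) :
  (forall a b, F (tens f f a b) = tens iR iR (jP a) (jP b)) ->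
  forall t, F t = 0 -> exists2 v, v != 0 & tensl f f (f v) * t = 0.
Proof.
move=> FE t Ft.
have [W [cls cls0]] := @germs_exist D Q (fun v => v != 0) base_neq01 base_mulf_neq0.
pose phi r r' := cls (fun e => tens f f (cleared e r) (cleared e r')).
have clsE (G H : D -> Q) d : d != 0 -> (forall e, G (d * e) = H (d * e)) -> cls G = cls H.
  move=> d0 GH; apply/eqP; rewrite -subr_eq0 -raddfB; apply/eqP/cls0.
  by exists d => // e; rewrite -[LHS]/(G (d * e) - H (d * e)) GH subrr.
have bal : balanced iR iR phi.
  split=> [b b' m|b m m'|w b m].
  - have [d [p [d0 dp]]] := den_R b; have [d' [p' [d'0 dp']]] := den_R b'.
    rewrite -raddfD; apply: (clsE _ _ (d * d')); first exact: base_mulf_neq0.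
    move=> e; rewrite addrfctE /=.
    rewrite (@clearedE _ b (f (d' * e) * p)); last first.
      by rewrite (rmorphM jP) jPf -dp !rmorphM /=; ring.
    rewrite (@clearedE _ b' (f (d * e) * p')); last first.
      by rewrite (rmorphM jP) jPf -dp' !rmorphM /=; ring.
    rewrite -tensDl; congr tens; apply: clearedE.
    by rewrite rmorphD /= !(rmorphM jP) !jPf -dp -dp' !rmorphM /=; ring.
  - have [d [p [d0 dp]]] := den_R m; have [d' [p' [d'0 dp']]] := den_R m'.
    rewrite -raddfD; apply: (clsE _ _ (d * d')); first exact: base_mulf_neq0.
    move=> e; rewrite addrfctE /=.
    rewrite (@clearedE _ m (f (d' * e) * p)); last first.
      by rewrite (rmorphM jP) jPf -dp !rmorphM /=; ring.
    rewrite (@clearedE _ m' (f (d * e) * p')); last first.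
      by rewrite (rmorphM jP) jPf -dp' !rmorphM /=; ring.
    rewrite -tensDr; congr tens; apply: clearedE.
    by rewrite rmorphD /= !(rmorphM jP) !jPf -dp -dp' !rmorphM /=; ring.
  - have [u [v [v0 wv]]] := den_K w.
    have [d [p [d0 dp]]] := den_R b; have [d' [p' [d'0 dp']]] := den_R m.
    apply: (clsE _ _ (v * d * d')); first by rewrite !base_mulf_neq0.
    move=> e /=.
    have wv' : iR w * iR (jD v) = iR (jD u) by rewrite -rmorphM wv.
    rewrite (@clearedE _ (iR w * b) (f (u * d' * e) * p)); last first.
      by rewrite (rmorphM jP) jPf -dp !rmorphM /= -wv'; ring.
    rewrite (@clearedE _ m (f (v * d * e) * p')); last first.
      by rewrite (rmorphM jP) jPf -dp' !rmorphM /=; ring.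
    rewrite (@clearedE _ b (f (v * d' * e) * p)); last first.
      by rewrite (rmorphM jP) jPf -dp !rmorphM /=; ring.
    rewrite (@clearedE _ (iR w * m) (f (u * d * e) * p')); last first.
      by rewrite (rmorphM jP) jPf -dp' !rmorphM /= -wv'; ring.
    rewrite !tens_bal !mulrA -!rmorphM; congr (tens f f p (f _ * p')); ring.
have : \pi_(tensor iR iR) [seq (jP p.1, jP p.2) | p <- repr t] = \pi_(tensor iR iR) [::].
  rewrite [RHS](_ : _ = 0) // -Ft {2}(tensE t) rmorph_sum tensor_seqE big_map.
  by apply: eq_bigr => p _; rewrite FE.
move=> /eqquotP/asboolP/(_ W phi bal); rewrite big_nil big_map => Z.
have : cls (\sum_(p <- repr t) (fun e => tens f f (cleared e (jP p.1)) (cleared e (jP p.2)))) = 0.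
  by rewrite raddf_sum.
(* at e = d the germ is d^2 t *)
case/cls0 => d d0 /(_ 1) dt; exists (d * d); first exact: base_mulf_neq0.
rewrite -dt fct_sumE {1}(tensE t) mulr_sumr; apply: eq_bigr => p _.
have cE q : cleared d (jP q) = f d * q by apply: clearedE; rewrite rmorphM jPf.
rewrite mulr1 !cE rmorphM.
by rewrite tensM mul1r -tens_bal mulrA.
Qed.

Lemma den_tensor (F : {rmorphism Q -> RR}) :
  (forall a b, F (tens f f a b) = tens iR iR (jP a) (jP b)) ->
  forall z, exists v t, v != 0 /\ tensl iR iR (iR (jD v)) * z = F t.
Proof.
move=> FE; apply: tensor_rect => [x y [v [t [v0 vt]]] [w [s [w0 ws]]]||b m].
- exists (v * w), (tensl f f (f w) * t + tensl f f (f v) * s).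
  split; first exact: base_mulf_neq0.
  rewrite rmorphD (rmorphM F (tensl f f (f w))) (rmorphM F (tensl f f (f v))).
  rewrite !FE -vt -ws rmorph1 !jPf !rmorphM /= -!/(tensl _ _ _); ring.
- by exists 1, 0; rewrite base_neq01 rmorph0 mulr0.
- have [v [p [v0 vp]]] := den_R b; have [w [q [w0 wq]]] := den_R m.
  exists (v * w), (tens f f p q); split; first exact: base_mulf_neq0.
  rewrite FE -vp -wq -tens_bal tensM mul1r; congr tens; rewrite !rmorphM /=; ring.
Qed.

End Denominators.

(** * Constants of an extension of a simple ring *)

(** The part of [sd_simple] that survives without case distinctions: a nonzero
    stable ideal is the whole ring. *)
Definition sd_trivial (R : comPzRingType) (s d : R -> R) :=
  forall J : set R, sd_ideal s d J -> (exists2 u, J u & u != 0) -> J 1.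

Lemma sd_simple_trivial (R : comPzRingType) (s d : R -> R) :
  sd_simple s d -> sd_trivial s d.
Proof.
move=> [_ H] J /H [->|->] // [u ->]; by rewrite eqxx.
Qed.

Section ConstantSpan.
Variables (P Q : comPzRingType) (j : {rmorphism P -> Q}).
Variables (sP dP : P -> P) (sQ : {rmorphism Q -> Q}) (dQ : Q -> Q).
Hypothesis dQd : derivation dQ.
Hypotheses (jsP : forall r, j (sP r) = sQ (j r)) (jdP : forall r, j (dP r) = dQ (j r)).
Hypothesis Ptriv : sd_trivial sP dP.

Definition is_const w := constants sQ dQ w.

(** Combinations of the constants [ws] with coefficients in [P]; the list is
    kept fixed so that the length of a combination can be used for induction. *)
Fixpoint cspan (ws : seq Q) (t : Q) : Prop :=
  if ws is w :: ws' then exists r t', [/\ is_const w, cspan ws' t' & t = j r * w + t']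
  else t = 0.

Lemma cspanD ws t u : cspan ws t -> cspan ws u -> cspan ws (t + u).
Proof.
elim: ws t u => [|w ws IH] t u /=; first by move=> -> ->; rewrite addr0.
move=> [r [t' [wc t'P ->]]] [r' [u' [_ u'P ->]]].
by exists (r + r'), (t' + u'); split=> //; [exact: IH|rewrite rmorphD; ring].
Qed.

Lemma cspanM ws x t : cspan ws t -> cspan ws (j x * t).
Proof.
elim: ws t => [|w ws IH] t /=; first by move=> ->; rewrite mulr0.
move=> [r [t' [wc t'P ->]]].
by exists (x * r), (j x * t'); split=> //; [exact: IH|rewrite rmorphM; ring].
Qed.

Lemma cspan_sd ws t : cspan ws t -> cspan ws (sQ t) /\ cspan ws (dQ t).
Proof.
elim: ws t => [|w ws IH] t /=; first by move=> ->; rewrite rmorph0 (der0 dQd).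
move=> [r [t' [[ws_ wd] /IH [t's t'd] ->]]]; split.
  by exists (sP r), (sQ t'); split=> //; rewrite rmorphD rmorphM ws_ jsP.
exists (dP r), (dQ t'); split=> //.
by rewrite (derD dQd) (derM dQd) wd mulr0 addr0 jdP.
Qed.

Lemma cspan_const w : is_const w -> cspan [:: w] w.
Proof. by move=> wc; exists 1, 0; rewrite rmorph1 mul1r addr0. Qed.

Lemma cspan_cat ws ws' t t' : cspan ws t -> cspan ws' t' -> cspan (ws ++ ws') (t + t').
Proof.
elim: ws t => [|w ws IH] t /=; first by move=> ->; rewrite add0r.
move=> [r [u [wc uP ->]]] t'P; exists r, (u + t'); split=> //; first exact: IH.
by rewrite addrA.
Qed.

Lemma const_mul w w' : is_const w -> is_const w' -> is_const (w * w').
Proof.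
move=> [ws_ wd] [ws' wd']; split; first by rewrite rmorphM ws_ ws'.
by rewrite (derM dQd) wd wd' mul0r mulr0 addr0.
Qed.

Lemma cspan_mul ws ws' t t' : cspan ws t -> cspan ws' t' ->
  exists ws2, cspan ws2 (t * t').
Proof.
elim: ws t => [|w ws IH] t /=; first by move=> -> _; exists [::]; rewrite mul0r.
move=> [r [u [wc /IH uP ->]]] t'P; have [ws2 us] := uP t'P.
suff ws'P : cspan (map ( *%R w) ws') (j r * w * t').
  by exists (map ( *%R w) ws' ++ ws2); rewrite mulrDl; apply: cspan_cat.
rewrite -mulrA; apply: cspanM.
elim: ws' {us uP IH} t' t'P => [|w' ws' IHw] s /=; first by move=> ->; rewrite mulr0.
move=> [r' [u' [wc' u'P ->]]]; exists r', (w * u'); split.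
- exact: const_mul.
- exact: IHw.
- by ring.
Qed.

(** Take a shortest nonzero combination of constants in [N].  The leading
    coefficients of such combinations form a stable ideal of [P], so one of
    them has leading coefficient 1; applying [sQ - 1] or [dQ] to it gives a
    shorter element of [N], hence 0, so it is a constant and vanishes.  This
    expresses the leading constant through the others. *)
Lemma no_constant_ideal (N : set Q) : sd_ideal sQ dQ N ->
  (forall w, N w -> is_const w -> w = 0) ->
  forall ws t, cspan ws t -> N t -> t = 0.
Proof.
move=> [[N0 ND NM] Ns Nd] Nc; have NN a : N a -> N (- a).
  by move=> Na; rewrite -mulN1r; apply: NM.
elim=> [//|w ws IH] t /= [r [t' [wc t'P tE]]] Nt.
pose J : set P := [set x | exists2 u, cspan ws u & N (j x * w + u)].
have [[x Jx x0]|Jtriv] := pselect (exists2 x, J x & x != 0); last first.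
  have r0 : r = 0.
    apply/eqP; apply: contraT => rn; case: Jtriv; exists r => //.
    by exists t' => //; rewrite -tE.
  by apply: IH => //; rewrite tE r0 rmorph0 mul0r add0r.
have J1 : J 1.
  apply: Ptriv; last by exists x.
  split; first split.
  - by exists 0; rewrite ?rmorph0 ?mul0r ?addr0 // -(mul0r t');
      have := cspanM 0 t'P; rewrite rmorph0.
  - move=> a b [u us Nu] [v vs Nv]; exists (u + v); first exact: cspanD.
    have -> : j (a + b) * w + (u + v) = (j a * w + u) + (j b * w + v).
      by rewrite rmorphD; ring.
    exact: ND.
  - move=> a b [u us Nu]; exists (j a * u); first exact: cspanM.
    have -> : j (a * b) * w + j a * u = j a * (j b * w + u) by rewrite rmorphM; ring.
    exact: NM.
  - move=> a [u /cspan_sd [us _] /Ns Nu]; exists (sQ u) => //.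
    by move: Nu; rewrite rmorphD rmorphM wc.1 jsP.
  - move=> a [u /cspan_sd [_ us] /Nd Nu]; exists (dQ u) => //.
    by move: Nu; rewrite (derD dQd) (derM dQd) wc.2 mulr0 addr0 jdP.
have [u us] := J1; rewrite rmorph1 mul1r => Nu.
have [sus dus] := cspan_sd us.
(* w + u is a constant of N, by induction *)
have u0 : w + u = 0.
  apply: Nc => //; split.
    apply/eqP; rewrite -subr_eq0; apply/eqP; apply: IH.
      have -> : sQ (w + u) - (w + u) = sQ u - u by rewrite rmorphD wc.1; ring.
      apply: cspanD => //.
      by rewrite -mulN1r -(rmorph1 j) -rmorphN; apply: cspanM.
    by apply: ND; [apply: Ns|apply: NN].
  apply: IH; last exact: Nd.
  by rewrite (derD dQd) wc.2 add0r.
apply: IH => //; have -> : t = t' + j (- r) * u.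
  rewrite tE rmorphN -[w](addrK u) u0; ring.
exact/cspanD/cspanM.
Qed.

Section Retraction.
Variables (C : fieldType) (S : comPzRingType).
Variables (eP : {rmorphism P -> S}) (ph : {rmorphism Q -> S}).
Variable kP : {rmorphism C -> P}.
Hypothesis S1 : (1 : S) != 0.
Hypothesis phj : forall r, ph (j r) = eP r.
Hypotheses (skP : forall c, sP (kP c) = kP c) (dkP : forall c, dP (kP c) = 0).
Hypotheses (sPM : {morph sP : x y / x * y}) (sPB : {morph sP : x y / x - y}).
Hypotheses (sP1 : sP 1 = 1) (dPd : derivation dP).
Hypothesis phc : forall w, is_const w -> exists c, ph w = eP (kP c).
Hypothesis spanned : forall t, exists ws, cspan ws t.

(** The graph of the retraction [Q -> P] that replaces a constant of [Q] by the
    element of [C] which is its value under [ph]. *)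
Definition graph : {pred (Q * P)%type} := gen_subring
  [set x : Q * P | (exists r, x = (j r, r)) \/
     exists w c, [/\ is_const w, ph w = eP (kP c) & x = (w, kP c)]].

Lemma graph_j r : (j r, r) \in graph.
Proof. by apply: mem_gen_subring; left; exists r. Qed.

Lemma graph_const w c : is_const w -> ph w = eP (kP c) -> (w, kP c) \in graph.
Proof. by move=> wc wE; apply: mem_gen_subring; right; exists w, c. Qed.

Lemma graph_total t : exists p, (t, p) \in graph.
Proof.
have [ws] := spanned t; elim: ws t => [|w ws IH] t /=.
  move=> ->; exists 0; apply: (rpred0 graph).
move=> [r [t' [wc /IH [p' t'p'] ->]]]; have [c wE] := phc wc.
exists (r * kP c + p').
exact: (rpredD (rpredM (graph_j r) (graph_const wc wE)) t'p').
Qed.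

Lemma graph_eval x : x \in graph -> ph x.1 = eP x.2.
Proof.
apply: (@gen_subring_ind _ _ (fun x => ph x.1 = eP x.2)) => //=.
- by rewrite !rmorph1.
- by move=> a b ab ab'; rewrite !rmorphB ab ab'.
- by move=> a b ab ab'; rewrite !rmorphM ab ab'.
- by move=> _ [[r ->]|[w [c [_ wc ->]]]] /=; [exact: phj|].
Qed.

Lemma graph_s x : x \in graph -> (sQ x.1, sP x.2) \in graph.
Proof.
apply: (@gen_subring_ind _ _ (fun x => (sQ x.1, sP x.2) \in graph)) => /=.
- by rewrite rmorph1 sP1; apply: (rpred1 graph).
- by move=> a b ga gb; rewrite rmorphB sPB; apply: (rpredB ga gb).
- by move=> a b ga gb; rewrite rmorphM sPM; apply: (rpredM ga gb).
- move=> _ [[r ->]|[w [c [wc wE ->]]]] /=; first by rewrite -jsP; apply: graph_j.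
  by rewrite skP wc.1; apply: graph_const.
Qed.

Lemma graph_d x : x \in graph -> (dQ x.1, dP x.2) \in graph.
Proof.
move=> gx; suff: x \in graph /\ (dQ x.1, dP x.2) \in graph by case.
apply: (@gen_subring_ind _ _ (fun x => x \in graph /\ (dQ x.1, dP x.2) \in graph)) gx => /=.
- by rewrite (der1 dQd) (der1 dPd); split; [apply: (rpred1 graph)|apply: (rpred0 graph)].
- move=> a b [ga da] [gb db]; split; first exact: (rpredB ga gb).
  by rewrite (derB dQd) (derB dPd); apply: (rpredB da db).
- move=> a b [ga da] [gb db]; split; first exact: (rpredM ga gb).
  rewrite (derM dQd) (derM dPd).
  exact: (rpredD (rpredM da gb) (rpredM ga db)).
- move=> x0 gx0; split; first exact: mem_gen_subring.
  case: gx0 => [[r ->]|[w [c [wc wE ->]]]] /=; first by rewrite -jdP; apply: graph_j.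
  by rewrite dkP wc.2; apply: (rpred0 graph).
Qed.

(** The elements of [P] paired with 0 form a stable ideal, and [eP] kills
    them, since [ph] maps 0 to 0; so 1 is not among them. *)
Lemma graph_fun p : (0, p) \in graph -> p = 0.
Proof.
move=> gp; pose J : set P := [set q | (0, q) \in graph].
apply/eqP; apply: contraT => pn; have: J 1.
  apply: Ptriv; last by exists p.
  split; first split.
  - exact: (rpred0 graph).
  - by move=> a b ga gb; have := rpredD ga gb; rewrite /= /J /= -[(0, a) + _]/(0 + 0, a + b) addr0.
  - move=> r a ga; have := rpredM (graph_j r) ga.
    by rewrite -[(j r, r) * _]/(j r * 0, r * a) mulr0.
  - by move=> a /graph_s /=; rewrite rmorph0.
  - by move=> a /graph_d /=; rewrite (der0 dQd).
by move/graph_eval; rewrite /= rmorph0 rmorph1 => /esym/eqP; rewrite (negbTE S1).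
Qed.

Lemma graph_inj t p q : (t, p) \in graph -> (t, q) \in graph -> p = q.
Proof.
move=> gp gq; apply/eqP; rewrite -subr_eq0; apply/eqP/graph_fun.
by have := rpredB gp gq; rewrite -[(t, p) - _]/(t - t, p - q) subrr.
Qed.

Lemma retraction_exists : exists T : {rmorphism Q -> P},
  [/\ forall r, T (j r) = r, forall t, eP (T t) = ph t &
      forall w c, is_const w -> ph w = eP (kP c) -> T w = kP c].
Proof.
pose T0 t := projT1 (cid (graph_total t)).
have gT t : (t, T0 t) \in graph by rewrite /T0; case: cid.
have [|||T TE] := @rmorphism_of_fun Q P T0.
- by move=> a b; apply: graph_inj (gT _) _; apply: (rpredD (gT a) (gT b)).
- by move=> a b; apply: graph_inj (gT _) _; apply: (rpredM (gT a) (gT b)).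
- by apply: graph_inj (gT _) _; apply: (rpred1 graph).
exists T; split=> [r|t|w c wc wE]; rewrite TE.
- exact: graph_inj (gT _) (graph_j r).
- exact/esym/(graph_eval (gT t)).
- exact: graph_inj (gT _) (graph_const wc wE).
Qed.

End Retraction.
End ConstantSpan.

(** * Self-products of a Picard-Vessiot ring *)

Section Descent.
Variables (K : fieldType) (R D P : comPzRingType).
Variables (iR : {rmorphism K -> R}) (jD : {rmorphism D -> K}).
Variables (jP : {rmorphism P -> R}) (f : {rmorphism D -> P}).
Hypotheses (jD_inj : injective jD) (jP_inj : injective jP).
Hypothesis jPf : forall u, jP (f u) = iR (jD u).
Hypothesis den_K : forall w, exists u v, v != 0 /\ w * jD v = jD u.
Hypothesis den_R : forall r, exists v p, v != 0 /\ iR (jD v) * r = jP p.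

Variables (sD dD : D -> D) (sK : {rmorphism K -> K}) (dK : K -> K).
Variables (sP : {rmorphism P -> P}) (dP : P -> P).
Variables (sR : {rmorphism R -> R}) (dR : R -> R).
Hypotheses (dPd : derivation dP) (dRd : derivation dR).
Hypotheses (jDs : forall u, jD (sD u) = sK (jD u)).
Hypotheses (jDd : forall u, jD (dD u) = dK (jD u)).
Hypotheses (iRs : forall q, iR (sK q) = sR (iR q)).
Hypotheses (iRd : forall q, iR (dK q) = dR (iR q)).
Hypotheses (jPs : forall p, jP (sP p) = sR (jP p)).
Hypotheses (jPd : forall p, jP (dP p) = dR (jP p)).
Hypotheses (Rsimple : sd_simple sR dR) (Dtriv : sd_trivial sD dD).

Variables (n : nat) (X Y : 'M[P]_n) (A B : 'M[D]_n).
Hypotheses (XY : X *m Y = 1%:M) (YX : Y *m X = 1%:M).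
Hypotheses (sX : map_mx sP X = map_mx f A *m X).
Hypotheses (dX : map_mx dP X = map_mx f B *m X).
Hypothesis gen_P : forall p, p \in gen_subring
  (range f `|` [set p | exists i j, p = X i j \/ p = Y i j]).

Notation Q := (tensor f f).
Notation RR := (tensor iR iR).

Lemma sPf u : sP (f u) = f (sD u).
Proof. by apply: jP_inj; rewrite jPs !jPf jDs iRs. Qed.
Lemma dPf u : dP (f u) = f (dD u).
Proof. by apply: jP_inj; rewrite jPd !jPf jDd iRd. Qed.

Lemma sD_neq0 u : u != 0 -> sD u != 0.
Proof.
by rewrite -!(inj_eq jD_inj) jDs rmorph0 fmorph_eq0.
Qed.

(** Extending a stable ideal of [P] to [R] gives the whole of [R], so the
    ideal contains a nonzero element of [D]; what it cuts out on [D] is again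
    a stable ideal. *)
Lemma P_trivial : sd_trivial sP dP.
Proof.
move=> J [[J0 JD JM] Js Jd] [p0 Jp0 p00].
pose N : set R := [set r | exists v p, [/\ v != 0, J p & iR (jD v) * r = jP p]].
have N1 : N 1.
  apply: (sd_simple_trivial Rsimple); last first.
    exists (jP p0); last by rewrite -(rmorph0 jP) (inj_eq jP_inj).
    by exists 1, p0; rewrite (base_neq01 jD) !rmorph1 mul1r.
  split; first split.
  - by exists 1, 0; rewrite (base_neq01 jD) !rmorph0 mulr0.
  - move=> a b [v [p [v0 Jp vp]]] [w [q [w0 Jq wq]]].
    exists (v * w), (f w * p + f v * q); split.
    + exact: (base_mulf_neq0 jD_inj).
    + by apply: JD; apply: JM.
    + by rewrite rmorphD !(rmorphM jP) !jPf -vp -wq !rmorphM /=; ring.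
  - move=> r a [v [p [v0 Jp vp]]]; have [w [q [w0 wq]]] := den_R r.
    exists (v * w), (q * p); split.
    + exact: (base_mulf_neq0 jD_inj).
    + exact: JM.
    + by rewrite !(rmorphM jP) -vp -wq !rmorphM /=; ring.
  - move=> a [v [p [v0 Jp vp]]]; exists (sD v), (sP p); split.
    + exact: sD_neq0.
    + exact: Js.
    + by rewrite jPs jDs iRs -vp rmorphM.
  - move=> a [v [p [v0 Jp vp]]]; exists (v * v), (f v * dP p + (- f (dD v)) * p); split.
    + exact: (base_mulf_neq0 jD_inj).
    + by apply: JD; apply: JM => //; apply: Jd.
    + rewrite rmorphD !(rmorphM jP) rmorphN !jPf jPd -vp (derM dRd) jDd iRd.
      by rewrite !rmorphM /=; ring.
have [v [p [v0 Jp]]] := N1; rewrite mulr1 -jPf => /jP_inj vp.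
pose N' : set D := [set u | J (f u)].
suff: N' 1 by rewrite /N' /= rmorph1.
apply: Dtriv; last by exists v => //; rewrite /N' /= vp.
split; first split.
- by rewrite /N' /= rmorph0.
- by move=> a b; rewrite /N' /= rmorphD; apply: JD.
- by move=> r a; rewrite /N' /= rmorphM; apply: JM.
- by move=> a; rewrite /N' /= -sPf; apply: Js.
- by move=> a; rewrite /N' /= -dPf; apply: Jd.
Qed.

Variables (sQ : {rmorphism Q -> Q}).
Hypothesis sQE : sQ = tensor_end sP sP :> (Q -> Q).
Notation dQ := (tensor_der dP dP : Q -> Q).

Let dQd : derivation dQ := tensor_der_derivation dPd dPd dPf dPf.

Lemma sQl r : sQ (tensl f f r) = tensl f f (sP r).
Proof. by rewrite sQE (tensor_endE sPf sPf) rmorph1. Qed.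
Lemma sQr r : sQ (tensr f f r) = tensr f f (sP r).
Proof. by rewrite sQE (tensor_endE sPf sPf) rmorph1. Qed.
Lemma dQl r : dQ (tensl f f r) = tensl f f (dP r).
Proof. by rewrite (tensor_derE dPd dPd dPf dPf) (der1 dPd) tens0r addr0. Qed.
Lemma dQr r : dQ (tensr f f r) = tensr f f (dP r).
Proof. by rewrite (tensor_derE dPd dPd dPf dPf) (der1 dPd) tens0l add0r. Qed.

Lemma tensr_base u : tensr f f (f u) = tensl f f (f u).
Proof. by have := tens_bal f f u 1 1; rewrite !mulr1. Qed.

(** Two fundamental matrices of the same system differ by a constant matrix.
    The maps [l] and [r] are the two embeddings of [P] in [Q], in either
    order, so that this covers both [Z] and its inverse. *)
Lemma fundamental_ratio_const (l r : {rmorphism P -> Q}) :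
  (forall u, r (f u) = l (f u)) ->
  (forall p, sQ (l p) = l (sP p)) -> (forall p, sQ (r p) = r (sP p)) ->
  (forall p, dQ (l p) = l (dP p)) -> (forall p, dQ (r p) = r (dP p)) ->
  forall i j, is_const sQ dQ ((map_mx l Y *m map_mx r X) i j).
Proof.
move=> lr ls rs ld rd i j.
(* sigma(X) = A X, so sigma(X^-1) A = X^-1: only A itself has to be moved across the tensor sign *)
have sYA : map_mx sP Y *m map_mx f A = Y.
  by rewrite -[_ *m _]mulmx1 -XY mulmxA -[_ *m _ *m X]mulmxA -sX -map_mxM YX map_mx1 mul1mx.
have lrM (M : 'M[D]_n) : map_mx r (map_mx f M) = map_mx l (map_mx f M).
  by apply/matrixP => a b; rewrite !mxE lr.
have sl M : map_mx sQ (map_mx l M) = map_mx l (map_mx sP M).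
  by apply/matrixP => a b; rewrite !mxE ls.
have sr M : map_mx sQ (map_mx r M) = map_mx r (map_mx sP M).
  by apply/matrixP => a b; rewrite !mxE rs.
have dl M : map_mx dQ (map_mx l M) = map_mx l (map_mx dP M).
  by apply/matrixP => a b; rewrite !mxE ld.
have dr M : map_mx dQ (map_mx r M) = map_mx r (map_mx dP M).
  by apply/matrixP => a b; rewrite !mxE rd.
split.
  have : map_mx sQ (map_mx l Y *m map_mx r X) = map_mx l Y *m map_mx r X.
    by rewrite map_mxM sl sr sX map_mxM lrM mulmxA -map_mxM sYA.
  by move/matrixP/(_ i j); rewrite mxE.
have : map_mx dQ (map_mx l Y *m map_mx r X) = 0.
  rewrite (der_mulmx dQd) dl dr (der_invmx dPd XY YX dX) dX.
  by rewrite map_mxN !map_mxM lrM mulNmx mulmxA addNr.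
by move/matrixP/(_ i j); rewrite !mxE.
Qed.

Definition transition : 'M[Q]_n := map_mx (tensl f f) Y *m map_mx (tensr f f) X.

Lemma transition_is_const i j : is_const sQ dQ (transition i j).
Proof.
by apply: fundamental_ratio_const; [exact: tensr_base|exact: sQl|exact: sQr|exact: dQl|exact: dQr].
Qed.

Notation spanQ := (cspan (tensl f f) sQ dQ).

Lemma spanned_by_constants t : exists ws, spanQ ws t.
Proof.
have c1 : is_const sQ dQ 1 by split; [exact: rmorph1|exact: (der1 dQd)].
have spanned_l r : exists ws, spanQ ws (tensl f f r).
  exists [:: 1]; have := cspanM r (cspan_const (tensl f f) c1); by rewrite mulr1.
have spanned_c w : is_const sQ dQ w -> exists ws, spanQ ws w.
  by move=> wc; exists [:: w]; apply: cspan_const.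
have spannedD a b : (exists ws, spanQ ws a) -> (exists ws, spanQ ws b) ->
    exists ws, spanQ ws (a + b).
  by move=> [ws wa] [ws' wb]; exists (ws ++ ws'); apply: cspan_cat.
have spannedM a b : (exists ws, spanQ ws a) -> (exists ws, spanQ ws b) ->
    exists ws, spanQ ws (a * b).
  by move=> [ws wa] [ws' wb]; apply: (cspan_mul dQd wa wb).
have span_zero : exists ws, spanQ ws 0 by exists [::].
have spanned_sum I (s : seq I) (F : I -> Q) :
    (forall i, exists ws, spanQ ws (F i)) -> exists ws, spanQ ws (\sum_(i <- s) F i).
  by move=> FP; apply: (big_ind (fun t => exists ws, spanQ ws t)).
suff spanned_r r : exists ws, spanQ ws (tensr f f r).
  apply: (@tensor_rect D P P f f (fun t => exists ws, spanQ ws t)) => //.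
  by move=> b m; rewrite tens_lr; apply: spannedM.
apply: (@gen_subring_ind _ _ (fun r => exists ws, spanQ ws (tensr f f r))) (gen_P r).
- by rewrite rmorph1; apply: spanned_c.
- move=> a b pa pb; rewrite rmorphB -mulN1r; apply: spannedD => //.
  apply: spannedM => //; have := spanned_l (-1); by rewrite rmorphN rmorph1.
- by move=> a b pa pb; rewrite rmorphM; apply: spannedM.
move=> _ [[u _ <-]|[i [j [->|->]]]]; first by rewrite tensr_base.
  have -> : tensr f f (X i j) = (map_mx (tensl f f) X *m transition) i j.
    by rewrite mulmxA -map_mxM XY map_mx1 mul1mx mxE.
  rewrite mxE; apply: spanned_sum => l; rewrite [map_mx _ _ _ _]mxE.
  by apply: spannedM => //; apply/spanned_c/transition_is_const.
(* Z' is the inverse of the transition matrix *)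
pose Z' := map_mx (tensr f f) Y *m map_mx (tensl f f) X.
have -> : tensr f f (Y i j) = (Z' *m map_mx (tensl f f) Y) i j.
  by rewrite -mulmxA -map_mxM XY map_mx1 mulmx1 mxE.
rewrite mxE; apply: spanned_sum => l; rewrite [map_mx _ Y _ _]mxE.
apply: spannedM => //; apply: spanned_c; apply: fundamental_ratio_const.
- by move=> u; exact: (esym (tensr_base u)).
- exact: sQr.
- exact: sQl.
- exact: dQr.
- exact: dQl.
Qed.

Variable F : {rmorphism Q -> RR}.
Hypothesis FE : forall a b, F (tens f f a b) = tens iR iR (jP a) (jP b).
Notation sRR := (tensor_end sR sR : RR -> RR).
Notation dRR := (tensor_der dR dR : RR -> RR).

Lemma base_change_sigma t : F (sQ t) = sRR (F t).
Proof.
have [G GE] := tensor_end_rmorph (fun a => esym (iRs a)) (fun a => esym (iRs a)).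
rewrite -GE; have := @rmorph_tensor_eq D P P f f RR (F \o sQ) (G \o F).
apply=> p /=; rewrite ?sQl ?sQr GE !FE
  (tensor_endE (fun a => esym (iRs a)) (fun a => esym (iRs a))).
  by rewrite jPs !rmorph1.
by rewrite jPs !rmorph1.
Qed.

Lemma base_change_delta t : F (dQ t) = dRR (F t).
Proof.
have dRi a := esym (iRd a).
have dRRd := tensor_der_derivation dRd dRd dRi dRi.
elim/tensor_rect: t => [u v|| a b].
- by rewrite (derD dQd) !rmorphD (derD dRRd) => -> ->.
- by rewrite (der0 dQd) rmorph0 (der0 dRRd).
- by rewrite (tensor_derE dPd dPd dPf dPf) rmorphD !FE (tensor_derE dRd dRd dRi dRi) !jPd.
Qed.

(** The kernel consists of torsion, and a torsion constant is zero: its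
    annihilator in [D] is a nonzero stable ideal. *)
Lemma base_change_inj t : F t = 0 -> t = 0.
Proof.
have dRi a := esym (iRd a).
have dRRd := tensor_der_derivation dRd dRd dRi dRi.
have [ws wst] := spanned_by_constants t; move: ws t wst.
apply: (no_constant_ideal dQd (fun r => esym (sQl r)) (fun r => esym (dQl r))
  P_trivial (N := [set t | F t = 0])).
  split; first split.
  - exact: rmorph0.
  - by move=> a b a0 b0; rewrite /= rmorphD a0 b0 addr0.
  - by move=> r a a0; rewrite /= rmorphM a0 mulr0.
  - move=> a a0; rewrite /= base_change_sigma a0.
    have [G <-] := tensor_end_rmorph (fun a => esym (iRs a)) (fun a => esym (iRs a)).
    exact: rmorph0.
  - by move=> a a0; rewrite /= base_change_delta a0 (der0 dRRd).
move=> w /(base_change_torsion jD_inj jP_inj jPf den_K den_R FE) [v v0 vw] [ws_ wd].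
pose N : set D := [set u | tensl f f (f u) * w = 0].
suff: N 1 by rewrite /N /= !rmorph1 mul1r.
apply: Dtriv; last by exists v.
split; first split.
- by rewrite /N /= !rmorph0 mul0r.
- by move=> a b; rewrite /N /= !rmorphD mulrDl => -> ->; rewrite addr0.
- by move=> r a; rewrite /N /= !rmorphM -mulrA => ->; rewrite mulr0.
- by move=> a /(congr1 sQ); rewrite rmorphM sQl sPf ws_ rmorph0.
- move=> a /(congr1 dQ); rewrite (derM dQd) dQl dPf wd mulr0 addr0.
  by rewrite (der0 dQd).
Qed.

(** The denominators of a constant [z] form a nonzero stable ideal of [D], so
    1 is one of them. *)
Lemma const_lift z : sRR z = z -> dRR z = 0 ->
  exists t, [/\ F t = z, is_const sQ dQ t & forall t', F t' = z -> t' = t].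
Proof.
move=> sz dz.
have dRi a := esym (iRd a).
have dRRd := tensor_der_derivation dRd dRd dRi dRi.
have [G GE] := tensor_end_rmorph (fun a => esym (iRs a)) (fun a => esym (iRs a)).
pose N : set D := [set u | exists t, tensl iR iR (iR (jD u)) * z = F t].
have [t tz] : N 1.
  apply: Dtriv; last first.
    have [v [t [v0 vt]]] := den_tensor jD_inj jPf den_R FE z.
    by exists v => //; exists t.
  split; first split.
  - by exists 0; rewrite !rmorph0 mul0r.
  - by move=> a b [t ta] [s sb]; exists (t + s); rewrite !rmorphD mulrDl ta sb.
  - move=> r a [t ta]; exists (tensl f f (f r) * t).
    rewrite [RHS]rmorphM -ta FE rmorph1 jPf -/(tensl _ _ _) mulrA; congr (_ * _).
    by rewrite -!rmorphM.
  - move=> a [t ta]; exists (sQ t); rewrite base_change_sigma -ta -GE rmorphM GE sz; congr (_ * _).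
    rewrite (tensor_endE (fun a => esym (iRs a)) (fun a => esym (iRs a))).
    by rewrite rmorph1 jDs iRs.
  - move=> a [t ta]; exists (dQ t); rewrite base_change_delta -ta (derM dRRd) dz mulr0 addr0.
    congr (_ * _); rewrite (tensor_derE dRd dRd dRi dRi) (der1 dRd) tens0r addr0.
    by rewrite jDd iRd.
move: tz; rewrite !rmorph1 mul1r => tz.
have uniq s s' : F s = F s' -> s = s'.
  move=> ss; apply/eqP; rewrite -subr_eq0; apply/eqP/base_change_inj.
  by rewrite rmorphB ss subrr.
exists t; split=> //; last by move=> t' t'z; apply: uniq; rewrite t'z tz.
split; apply: uniq; first by rewrite base_change_sigma -tz sz.
by rewrite base_change_delta -tz dz rmorph0.
Qed.

(** As constants lift uniquely to [Q], a morphism [ph] that takes values of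
    [C] at the constants of [Q] restricts to a point of the ring of constants
    of [RR]. *)
Lemma constants_eval (C : fieldType) (S : comNzRingType) (ph : {rmorphism Q -> S})
    (kS : {rmorphism C -> S}) :
  (forall w, is_const sQ dQ w -> exists c, ph w = kS c) ->
  exists g : {rmorphism adjoin (constants sRR dRR) -> C},
    forall z t, F t = val z -> ph t = kS (g z).
Proof.
move=> phc.
have dRi a := esym (iRd a).
have dRRd := tensor_der_derivation dRd dRd dRi dRi.
have [G GE] := tensor_end_rmorph (fun a => esym (iRs a)) (fun a => esym (iRs a)).
have zc (z : adjoin (constants sRR dRR)) : sRR (val z) = val z /\ dRR (val z) = 0.
  suff: G (val z) = val z /\ dRR (val z) = 0 by rewrite GE.
  apply: (@gen_subring_ind _ _ (fun z => G z = z /\ dRR z = 0)) (valP z).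
  - by rewrite rmorph1 (der1 dRRd).
  - by move=> a b [a1 a2] [b1 b2]; rewrite rmorphB (derB dRRd) a1 a2 b1 b2 subrr.
  - move=> a b [a1 a2] [b1 b2]; rewrite rmorphM (derM dRRd) a1 a2 b1 b2.
    by rewrite mul0r mulr0 addr0.
  - by move=> a [a1 a2]; rewrite GE.
have ex (z : adjoin (constants sRR dRR)) :
    exists c, forall t, F t = val z -> ph t = kS c.
  have [t [_ tc tU]] := const_lift (zc z).1 (zc z).2.
  by have [c tE] := phc t tc; exists c => t' /tU ->.
pose g0 z := projT1 (cid (ex z)).
have g0P (z : adjoin (constants sRR dRR)) t :
    F t = val z -> ph t = kS (g0 z).
  by rewrite /g0; case: cid => c /= /[apply].
have kSi := fmorph_inj kS.
have lift (z : adjoin (constants sRR dRR)) : exists t, F t = val z.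
  by have [t [tz _ _]] := const_lift (zc z).1 (zc z).2; exists t.
have [|||g gE] := @rmorphism_of_fun _ _ g0.
- move=> x y; have [t tx] := lift x; have [s sy] := lift y; apply: kSi.
  by rewrite -(g0P _ (t + s)) ?rmorphD ?(g0P x t) ?(g0P y s) // tx sy.
- move=> x y; have [t tx] := lift x; have [s sy] := lift y; apply: kSi.
  by rewrite -(g0P _ (t * s)) ?rmorphM ?(g0P x t) ?(g0P y s) //= tx sy.
- by apply: kSi; rewrite -(g0P _ 1) ?rmorph1.
by exists g => z t zt; rewrite gE; apply: g0P.
Qed.

(** The map [eP (x) eP'] from [Q] to [S] yields both the point [g] of the
    Galois group of [R] and, through the retraction, the endomorphism [tau]
    of [P] corresponding to it. *)
Lemma torsor_point (C : fieldType) (S : comNzRingType) (dS : S -> S)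
    (eP eP' : {rmorphism P -> S}) (kP : {rmorphism C -> P}) (m : 'M[C]_n) :
  derivation dS -> (forall p, dS (eP p) = eP (dP p)) ->
  (forall p, dS (eP' p) = eP' (dP p)) -> (forall u, eP' (f u) = eP (f u)) ->
  (forall a, sP (kP a) = kP a) -> (forall a, dP (kP a) = 0) ->
  (forall s, dS s = 0 -> exists a, s = eP (kP a)) ->
  map_mx eP Y *m map_mx eP' X = map_mx (eP \o kP) m ->
  exists (g : {rmorphism adjoin (constants sRR dRR) -> C}) (tau : {rmorphism P -> P}),
  [/\ forall a z, val z = tens iR iR (jP (kP a)) 1 -> g z = a,
      forall i j, exists2 z : adjoin (constants sRR dRR), g z = m i j &
         val z = \sum_l tens iR iR (jP (Y i l)) (jP (X l j)),
      forall u, tau (f u) = f u, forall p, eP (tau p) = eP' p &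
      map_mx tau X = X *m map_mx kP m].
Proof.
move=> dSd ed ed' ef ks kd cS mE.
have [ph phE] := tensor_lift (fun u => esym (ef u)).
have phl r : ph (tensl f f r) = eP r by rewrite phE rmorph1 mulr1.
have phr r : ph (tensr f f r) = eP' r by rewrite phE rmorph1 mul1r.
have phd t : ph (dQ t) = dS (ph t).
  elim/tensor_rect: t => [u v|| a b].
  - by rewrite (derD dQd) !rmorphD (derD dSd) => -> ->.
  - by rewrite (der0 dQd) rmorph0 (der0 dSd).
  - by rewrite (tensor_derE dPd dPd dPf dPf) rmorphD !phE (derM dSd) ed ed'.
have phc w : is_const sQ dQ w -> exists a, ph w = (eP \o kP) a.
  by case=> _ dw; apply: cS; rewrite -phd dw rmorph0.
have phZ i j : ph (transition i j) = eP (kP (m i j)).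
  have -> : eP (kP (m i j)) = map_mx (eP \o kP) m i j by rewrite mxE.
  rewrite -mE !mxE rmorph_sum; apply: eq_bigr => l _.
  by rewrite !mxE rmorphM phl phr.
have [g gE] := constants_eval phc.
have [T [Tl Te Tc]] := retraction_exists dQd (fun r => esym (sQl r))
  (fun r => esym (dQl r)) P_trivial (oner_neq0 S) phl ks kd (rmorphM sP) (rmorphB sP)
  (rmorph1 sP) dPd phc spanned_by_constants.
have inj := fmorph_inj (eP \o kP).
exists g, (T \o tensr f f); split.
- move=> a z zE; apply: inj; rewrite -(gE z (tensl f f (kP a))) ?phl //.
  by rewrite FE rmorph1 zE.
- move=> i j; have [ts td] := transition_is_const i j.
  have zc : F (transition i j) \in gen_subring (constants sRR dRR).
    by apply: mem_gen_subring; split;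
      rewrite -?base_change_sigma -?base_change_delta ?ts ?td ?rmorph0.
  exists (Adjoin zc).
    by apply: inj; rewrite -(gE _ (transition i j)) ?phZ.
  rewrite /= mxE rmorph_sum; apply: eq_bigr => l _.
  by rewrite !mxE -tens_lr FE.
- by move=> u; rewrite /= tensr_base Tl.
- by move=> p; rewrite /= Te phr.
- have XZ : map_mx (tensr f f) X = map_mx (tensl f f) X *m transition.
    by rewrite mulmxA -map_mxM XY map_mx1 mul1mx.
  rewrite map_mx_comp XZ map_mxM; congr (_ *m _); apply/matrixP => i j.
    by rewrite !mxE Tl.
  rewrite [LHS]mxE [RHS]mxE; apply: Tc; first exact: transition_is_const.
  exact: phZ.
Qed.

End Descent.

(** * The operators on k0(x) and on the localized base *)

Section PolyDerivation.
Variables (A : comNzRingType) (d : A -> A).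
Hypothesis dd : derivation d.

Lemma map_poly_derivation : derivation (map_poly d).
Proof.
have d0 := der0 dd; split=> p q; apply/polyP => i.
  by rewrite coefD !coef_map_id0 // coefD (derD dd).
rewrite coefD coef_map_id0 // !coefM (der_sum dd) -big_split.
by apply: eq_bigr => k _ /=; rewrite (derM dd) !coef_map_id0.
Qed.
End PolyDerivation.

(** Such a polynomial takes the same value at all natural numbers. *)
Lemma shift_fixed (A : idomainType) (p : {poly A}) :
  (forall m, m.+1%:R != 0 :> A) -> p \Po ('X + 1) = p -> p = (p`_0)%:P.
Proof.
move=> char0 pE.
have ev m : p.[m%:R] = p.[0].
  elim: m => [//|m <-]; rewrite -{2}pE horner_comp !hornerE -natr1 //.
have inj : injective (fun m : nat => m%:R : A).
  suff H a b : (a <= b)%N -> a%:R = b%:R :> A -> a = b.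
    by move=> a b ab; case/orP: (leq_total a b) => /H; [apply|move/(_ (esym ab))].
  move=> /subnK <-; case: (b - a)%N => [//|m] /eqP.
  by rewrite natrD -subr_eq0 opprD addrCA subrr addr0 oppr_eq0 (negbTE (char0 m)).
apply/eqP; rewrite -subr_eq0 -horner_coef0; apply: contraT => q0.
have := max_poly_roots q0 (rs := [seq m%:R | m <- iota 0 (size (p - p.[0]%:P))]).
rewrite size_map size_iota ltnn map_inj_uniq // iota_uniq.
move=> -> //; apply/allP => _ /mapP[m _ ->].
by rewrite /root !hornerE ev subrr.
Qed.

Lemma poly_common_denom (E : idomainType) (p : {poly {fraction E}}) :
  exists d (q : {poly E}), d != 0 /\ (tofrac d)%:P * p = map_poly (@tofrac E) q.
Proof.
have [d d0 dP] := common_denom p.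
have ex i : exists a, tofrac d * p`_i = tofrac a.
  have [ip|ip] := ltnP i (size p); first by apply: dP; apply: mem_nth.
  by exists 0; rewrite nth_default // mulr0 tofrac0.
exists d, (\poly_(i < size p) projT1 (cid (ex i))); split=> //.
apply/polyP => i; rewrite coefCM coef_map coef_poly /=.
case: ltnP => ip; first by case: cid.
by rewrite nth_default // mulr0 tofrac0.
Qed.

Section BaseRing.
Variable DD : idomainType.

Fact poly_k0x_zmod : zmod_morphism (@poly_k0x DD).
Proof. by move=> p q; rewrite /poly_k0x !rmorphB. Qed.
Fact poly_k0x_monoid : monoid_morphism (@poly_k0x DD).
Proof. by split=> [|p q]; rewrite /poly_k0x ?rmorph1 // !rmorphM. Qed.
HB.instance Definition _ :=
  GRing.isZmodMorphism.Build {poly DD} (k0x DD) (@poly_k0x DD) poly_k0x_zmod.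
HB.instance Definition _ :=
  GRing.isMonoidMorphism.Build {poly DD} (k0x DD) (@poly_k0x DD) poly_k0x_monoid.

Lemma poly_k0x_inj : injective (@poly_k0x DD).
Proof.
move=> p q /eqP; rewrite tofrac_eq => /eqP /polyP pq; apply/polyP => i.
by have := pq i; rewrite !coef_map => /eqP; rewrite tofrac_eq => /eqP.
Qed.

Lemma k0x_quot (w : k0x DD) : exists p q : {poly DD}, q != 0 /\ w * poly_k0x q = poly_k0x p.
Proof.
have [d [n' [d0 nE]]] := poly_common_denom \n_(repr w).
have [e [m' [e0 mE]]] := poly_common_denom \d_(repr w).
have m0 : \d_(repr w) != 0 by exact: denom_ratioP.
exists (e%:P * n'), (d%:P * m'); split.
  rewrite mulf_neq0 ?polyC_eq0 //; apply: contraNneq m0 => m'0.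
  move/eqP: mE; rewrite m'0 rmorph0 mulf_eq0 polyC_eq0 tofrac_eq0 (negbTE e0) //.
rewrite /poly_k0x !(rmorphM (map_poly _)) /= -nE -mE !map_polyC /=.
have clear (F : fieldType) (a b c e' : F) : b != 0 ->
    a / b * (c * (e' * b)) = e' * (c * a) by move=> b0; field.
by rewrite {1}(frac_repr w) !tofracM clear // tofrac_eq0.
Qed.
End BaseRing.

Section Operators.
Variables (DD : idomainType) (dD : DD -> DD).
Hypothesis ddD : derivation dD.
Notation pk := (@poly_k0x DD).

Lemma sig_poly p : sig (pk p) = pk (p \Po ('X + 1)).
Proof.
set w := pk p; rewrite /sig /frac_end.
have /eqP := frac_repr w; set a := \n_(repr w); set b := \d_(repr w).
have b0 : b != 0 by exact: denom_ratioP.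
have tb : (tofrac b : k0x DD) != 0 by rewrite tofrac_eq0.
rewrite /w -[X in X == _](divr1) -[1 in X in X == _]tofrac1 eqr_div ?tofrac_eq0 ?oner_neq0 //.
rewrite -!tofracM tofrac_eq mulr1 => /eqP ab.
have b1 : b \Po ('X + 1) != 0.
  by rewrite comp_poly2_eq0 // -[1]polyC1 size_XaddC.
have tb1 : (tofrac (b \Po ('X + 1)) : k0x DD) != 0 by rewrite tofrac_eq0.
apply: (mulIf tb1); rewrite mulfVK // -tofracM -ab comp_polyM.
congr (tofrac (_ * _)); rewrite map_comp_poly rmorphD /= map_polyX rmorph1 //.
Qed.

Lemma del_poly p : del dD (pk p) = pk (map_poly dD p).
Proof.
have dk : derivation (dk0 dD) := frac_der_derivation ddD.
rewrite /del (frac_der_tofrac (map_poly_derivation dk)); congr tofrac.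
apply/polyP => i; rewrite coef_map_id0 ?(der0 dk) // !coef_map_id0 ?(der0 ddD) ?tofrac0 //.
by rewrite /dk0 frac_der_tofrac.
Qed.

Lemma del_derivation : derivation (del dD).
Proof. exact/frac_der_derivation/map_poly_derivation/frac_der_derivation. Qed.

Variable h : {poly DD}.
Hypothesis h0 : h != 0.
Variable sK : {rmorphism k0x DD -> k0x DD}.
Hypothesis sKE : sK = @sig DD :> (k0x DD -> k0x DD).

Notation D := (Dring h).

Lemma poly_in_D p : pk p \in gen_subring (gensD h).
Proof. by apply: mem_gen_subring; left; exists p. Qed.

Definition poly_D p : D := Adjoin (poly_in_D p).

Lemma sigma_h_neq0 i : sigma_h h i != 0.
Proof. by rewrite comp_poly2_eq0 // size_XaddC. Qed.

Lemma sigma_h_shift i : sigma_h h i \Po ('X + 1) = sigma_h h (i + 1).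
Proof.
rewrite /sigma_h -comp_polyA; congr (_ \Po _).
rewrite comp_polyD comp_polyX comp_polyC -addrA; congr (_ + _).
by rewrite rmorphD /= polyCD addrC polyC1.
Qed.

Lemma sig_D u : u \in gen_subring (gensD h) -> sig u \in gen_subring (gensD h).
Proof.
rewrite -sKE.
apply: (@gen_subring_ind _ _ (fun u => sK u \in gen_subring (gensD h))).
- by rewrite rmorph1 rpred1.
- by move=> a b; rewrite rmorphB; apply: rpredB.
- by move=> a b; rewrite rmorphM; apply: rpredM.
- move=> _ [[p _ <-]|[i _ <-]]; first by rewrite sKE sig_poly poly_in_D.
  rewrite fmorphV sKE sig_poly sigma_h_shift.
  by apply: mem_gen_subring; right; exists (i + 1).
Qed.

Lemma del_D u : u \in gen_subring (gensD h) -> del dD u \in gen_subring (gensD h).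
Proof.
have dd := del_derivation.
move=> uP0; suff: u \in gen_subring (gensD h) /\ del dD u \in gen_subring (gensD h) by case.
apply: (@gen_subring_ind _ _ (fun u => u \in gen_subring (gensD h) /\
   del dD u \in gen_subring (gensD h))) uP0.
- by rewrite (der1 dd) rpred0 rpred1.
- by move=> a b [? ?] [? ?]; rewrite (derB dd) !rpredB.
- by move=> a b [? ?] [? ?]; rewrite (derM dd) rpredM // rpredD // rpredM.
- move=> v uP; split; first exact: mem_gen_subring.
  case: uP => [[p _ <-]|[i _ <-]]; first by rewrite del_poly poly_in_D.
  have s0 : pk (sigma_h h i) != 0.
    by rewrite -(rmorph0 pk) (inj_eq (@poly_k0x_inj DD)) sigma_h_neq0.
  rewrite (der_inv dd (mulfV s0)) rpredN rpredM // ?rpredX ?del_poly ?poly_in_D //.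
  by apply: mem_gen_subring; right; exists i.
Qed.

Definition sigma_D : D -> D := restrict (@sig DD).
Definition delta_D : D -> D := restrict (del dD).

Lemma val_sigma_D u : val (sigma_D u) = sig (val u).
Proof. exact: (val_restrict sig_D). Qed.
Lemma val_delta_D u : val (delta_D u) = del dD (val u).
Proof. exact: (val_restrict del_D). Qed.

Hypothesis char0 : forall m, m.+1%:R != 0 :> DD.
Hypothesis DDsimple : d_simple dD.

Lemma D_quot (w : k0x DD) : exists u v : D, v != 0 /\ w * val v = val u.
Proof.
have [p [q [q0 wE]]] := k0x_quot w; exists (poly_D p), (poly_D q); split=> //.
by rewrite -val_eqE /= -(rmorph0 pk) (inj_eq (@poly_k0x_inj DD)).
Qed.

(** For a polynomial [r] of least degree in the ideal, r(x + 1) - r(x) has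
    smaller degree and thus vanishes, so [r] lies in [DD]; the elements of [DD]
    in the ideal form a d-ideal of [DD], which is then nonzero. *)
Lemma D_trivial : sd_trivial sigma_D delta_D.
Proof.
move=> J [[J0 JA JM] Js Jd] [u Ju u0].
have JB a b : J a -> J b -> J (a - b).
  by move=> Ja Jb; apply: JA => //; rewrite -mulN1r; apply: JM.
have [p Jp p0] : exists2 p, J (poly_D p) & p != 0.
  have [p [q [q0 wE]]] := k0x_quot (val u); exists p.
    have -> : poly_D p = poly_D q * u by apply: val_inj; rewrite /= -wE mulrC.
    exact: JM.
  apply: contraNneq u0 => pz; move/eqP: wE; rewrite pz rmorph0 mulf_eq0.
  rewrite -[X in _ || (_ == X)](rmorph0 pk) (inj_eq (@poly_k0x_inj DD)) (negbTE q0) orbF.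
  by move=> /eqP ?; apply/eqP/val_inj.
have ex : exists m, `[< exists p, [/\ J (poly_D p), p != 0 & size p = m] >].
  by exists (size p); apply/asboolP; exists p.
have [m /asboolP [r [Jr r0 rm]] rmin] := find_ex_minn ex.
pose r' := r \Po ('X + 1).
have s2 : size ('X + 1 : {poly DD}) = 2 by rewrite -[1]polyC1 size_XaddC.
have sr' : size r' = size r by exact: size_comp_poly2.
have lr' : lead_coef r' = lead_coef r.
  rewrite /r' lead_coef_comp ?s2 //.
  have -> : 'X + 1 = 'X + 1%:P :> {poly DD} by rewrite polyC1.
  by rewrite lead_coefXaddC expr1n mulr1.
have Jr' : J (poly_D r').
  have -> : poly_D r' = sigma_D (poly_D r); last exact: Js.
  by apply: val_inj; rewrite val_sigma_D /= sig_poly.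
(* r' - r has smaller degree, as the leading terms cancel *)
have rr' : r' = r.
  apply/eqP; rewrite -subr_eq0; apply: contraT => d0.
  have Jd' : J (poly_D (r' - r)).
    have -> : poly_D (r' - r) = poly_D r' - poly_D r; last exact: JB.
    by apply: val_inj; rewrite /= rmorphB.
  have : (size (r' - r)%R < size r)%N.
    have rpos : (0 < size r)%N by rewrite size_poly_gt0.
    rewrite -(prednK rpos) ltnS; apply/leq_sizeP => j.
    rewrite leq_eqVlt coefB => /predU1P [<-|jr].
      by rewrite -{1}sr' -!lead_coefE lr' subrr.
    by rewrite !nth_default ?subrr ?sr' // -(prednK rpos).
  rewrite rm ltnNge rmin //; apply/asboolP; by exists (r' - r).
have rC := shift_fixed char0 rr'; set c := r`_0 in rC.
have c0 : c != 0 by apply: contraNneq r0 => cz; rewrite rC cz.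
pose N : set DD := [set a | J (poly_D a%:P)].
have [_ /(_ N)] := DDsimple; case.
- split; first split.
  + by rewrite /N /= (_ : poly_D _ = 0) //; apply: val_inj; rewrite /= rmorph0.
  + move=> a b aN bN; rewrite /N /= (_ : poly_D _ = poly_D a%:P + poly_D b%:P).
      exact: JA.
    by apply: val_inj; rewrite /= polyCD rmorphD.
  + move=> a b bN; rewrite /N /= (_ : poly_D _ = poly_D a%:P * poly_D b%:P).
      exact: JM.
    by apply: val_inj; rewrite /= polyCM rmorphM.
  + move=> a aN; rewrite /N /= (_ : poly_D _ = delta_D (poly_D a%:P)); first exact: Jd.
    apply: val_inj; rewrite val_delta_D /= del_poly; congr pk; apply/polyP => i.
    by rewrite coef_map_id0 ?(der0 ddD) // !coefC; case: ifP; rewrite ?(der0 ddD).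
- move=> N0; have : N c by rewrite /N /= -rC.
  by rewrite N0 => cz; move: c0; rewrite cz eqxx.
- move=> NT; have : N 1 by rewrite NT.
  rewrite /N /= (_ : poly_D _ = 1) //; apply: val_inj; rewrite /= polyC1 rmorph1 //.
Qed.

End Operators.

(** * Specialization and automorphisms *)

Section Specialization.
Variables (C F : fieldType) (D P : comPzRingType) (iF : {rmorphism C -> F}).
Variables (f : {rmorphism D -> P}) (c : {rmorphism D -> F}).
Variables (dD : D -> D) (dP : P -> P) (dF : F -> F).
Hypotheses (dPd : derivation dP) (dFd : derivation dF).
Hypotheses (dPf : forall u, dP (f u) = f (dD u)) (dFc : forall u, dF (c u) = c (dD u)).
Hypothesis dF_C : forall a, dF (iF a) = 0.
Variables (n : nat) (X Y : 'M[P]_n) (B : 'M[D]_n).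
Hypotheses (XY : X *m Y = 1%:M) (YX : Y *m X = 1%:M).
Hypotheses (dX : map_mx dP X = map_mx f B *m X).
Hypothesis gen_P : forall p, p \in gen_subring
  (range f `|` [set p | exists i j, p = X i j \/ p = Y i j]).

Notation T := (tensor c f).
Notation tl := (tensl c f).
Notation tr := (tensr c f).
Notation dT := (tensor_der dF dP : T -> T).
Notation XT := (map_mx tr X).
Notation YT := (map_mx tr Y).
Notation CT := (tl \o iF).

Lemma tensr_baseT u : tr (f u) = tl (c u).
Proof. by have := tens_bal c f u 1 1; rewrite !mulr1. Qed.

Lemma XYT : XT *m YT = 1%:M. Proof. by rewrite -map_mxM XY map_mx1. Qed.
Lemma YXT : YT *m XT = 1%:M. Proof. by rewrite -map_mxM YX map_mx1. Qed.

Let dTd : derivation dT := tensor_der_derivation dFd dPd dFc dPf.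

Lemma dTl a : dT (tl a) = tl (dF a).
Proof. by rewrite (tensor_derE dFd dPd dFc dPf) (der1 dPd) tens0r addr0. Qed.
Lemma dTr p : dT (tr p) = tr (dP p).
Proof. by rewrite (tensor_derE dFd dPd dFc dPf) (der1 dFd) tens0l add0r. Qed.

Definition WT : 'M[T]_n := map_mx (tl \o c) B.

Lemma dXT : map_mx dT XT = WT *m XT.
Proof.
have -> : map_mx dT XT = map_mx tr (map_mx dP X) by apply/matrixP => i j; rewrite !mxE dTr.
rewrite dX map_mxM; congr (_ *m _); apply/matrixP => i j; rewrite !mxE; exact: tensr_baseT.
Qed.

Lemma T_ind (Pr : T -> Prop) :
  (forall u v, Pr u -> Pr v -> Pr (u - v)) -> (forall u v, Pr u -> Pr v -> Pr (u * v)) ->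
  (forall a, Pr (tl a)) -> (forall i j, Pr (tr (X i j))) -> (forall i j, Pr (tr (Y i j))) ->
  forall t, Pr t.
Proof.
move=> PB PM Pl PX PY.
have P0 : Pr 0 by have := Pl 0; rewrite rmorph0.
apply: tensor_rect => [u v Pu Pv||b m].
- by rewrite -[v]opprK; apply: (PB) => //; rewrite -[- v]sub0r; apply: PB.
- exact: P0.
- rewrite tens_lr; apply: (PM) => //.
  apply: (@gen_subring_ind _ _ (fun m => Pr (tr m))) (gen_P m).
  + exact: (Pl 1).
  + by move=> x y; rewrite rmorphB; apply: PB.
  + by move=> x y; rewrite rmorphM; apply: PM.
  + by move=> _ [[u _ <-]|[i [j [->|->]]]] //; rewrite tensr_baseT.
Qed.

Lemma inv_unique (V : comPzRingType) (M N N' : 'M[V]_n) :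
  N *m M = 1%:M -> M *m N' = 1%:M -> N = N'.
Proof. by move=> NM MN; rewrite -[N]mulmx1 -MN mulmxA NM mul1mx. Qed.

(** [T] is generated over [F] by the entries of a fundamental matrix and of its
    inverse, and morphisms preserve inverses. *)
Lemma T_rmorph_eq (V : comPzRingType) (g h : {rmorphism T -> V}) :
  (forall a, g (tl a) = h (tl a)) -> map_mx g XT = map_mx h XT ->
  forall t, g t = h t.
Proof.
move=> gl gX.
have gY : map_mx g YT = map_mx h YT.
  apply: (@inv_unique _ (map_mx g XT)); first by rewrite -map_mxM YXT map_mx1.
  by rewrite gX -map_mxM XYT map_mx1.
apply: T_ind => [u v|u v||i j|i j].
- by rewrite !rmorphB => -> ->.
- by rewrite !rmorphM => -> ->.
- exact: gl.
- by move/matrixP/(_ i j): gX; rewrite !mxE.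
- by move/matrixP/(_ i j): gY; rewrite !mxE.
Qed.

(** Both [rho XT] and [XT] satisfy the equation with matrix [WT], because [m]
    is constant; so the two sides agree on generators. *)
Lemma rho_delta (rho : {rmorphism T -> T}) m :
  (forall a, rho (tl a) = tl a) -> map_mx rho XT = XT *m map_mx CT m ->
  forall t, rho (dT t) = dT (rho t).
Proof.
move=> rl rX.
have rW : map_mx rho WT = WT by apply/matrixP => i j; rewrite !mxE /= rl.
have drX : map_mx dT (map_mx rho XT) = WT *m map_mx rho XT.
  rewrite rX (der_mulmx dTd) dXT.
  have -> : map_mx dT (map_mx CT m) = 0.
    by apply/matrixP => i j; rewrite !mxE /= dTl dF_C rmorph0.
  by rewrite mulmx0 addr0 mulmxA.
have rXY : map_mx rho XT *m map_mx rho YT = 1%:M by rewrite -map_mxM XYT map_mx1.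
have rYX : map_mx rho YT *m map_mx rho XT = 1%:M by rewrite -map_mxM YXT map_mx1.
have dYr := der_invmx dTd rXY rYX drX.
have dY := der_invmx dTd XYT YXT dXT.
apply: T_ind => [u v|u v|a|i j|i j].
- by rewrite (derB dTd) !rmorphB (derB dTd) => -> ->.
- by rewrite (derM dTd) rmorphD !rmorphM (derM dTd) => -> ->.
- by rewrite dTl !rl dTl.
- have /matrixP/(_ i j) := congr1 (map_mx rho) dXT; rewrite map_mxM rW -drX !mxE.
  by [].
- have /matrixP/(_ i j) := congr1 (map_mx rho) dY; rewrite map_mxN map_mxM rW -dYr !mxE.
  by [].
Qed.

Variables (I : set T) (S : comUnitRingType) (pi : {rmorphism T -> S}) (dS : S -> S).
Hypotheses (pi_surj : forall s, exists t, pi t = s) (pi_ker : forall t, pi t = 0 <-> I t).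
Hypothesis pi_d : forall t, pi (dT t) = dS (pi t).
Hypothesis I_max : maximal_d_ideal dT I.

Notation XS := (map_mx pi XT).
Notation YS := (map_mx pi YT).
Notation CS := (pi \o CT).

Lemma dS_derivation : derivation dS.
Proof.
split=> s s'; have [t <-] := pi_surj s; have [t' <-] := pi_surj s'.
  by rewrite -rmorphD -!pi_d (derD dTd) rmorphD.
by rewrite -rmorphM -!pi_d (derM dTd) rmorphD !rmorphM.
Qed.

Lemma S_simple : d_simple dS.
Proof.
split=> [|J [[J0 JD JM] Jd]]; first exact: oner_neq0.
have [_ _ Imax] := I_max.
pose N : set T := [set t | J (pi t)].
have [JT|JnT] := pselect (J = setT); first by right.
left; have NI : N = I.
  apply: Imax.
  - split; first split.
    + by rewrite /N /= rmorph0.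
    + by move=> a b; rewrite /N /= rmorphD; apply: JD.
    + by move=> r a; rewrite /N /= rmorphM; apply: JM.
    + by move=> a; rewrite /N /= pi_d; apply: Jd.
  - by move=> t /pi_ker pt; rewrite /N /= pt.
  - move=> NT; apply: JnT; apply/predeqP => s; split=> // _.
    by have [t <-] := pi_surj s; have : N t by rewrite NT.
apply/predeqP => s; split=> [|->//]; have [t <-] := pi_surj s => Jt.
by have : N t by []; rewrite NI => /pi_ker.
Qed.

Lemma gen_S s : s \in gen_subring
  (range (pi \o tl) `|` [set s | exists i j, s = XS i j \/ s = YS i j]).
Proof.
have [t <-] := pi_surj s; move: t.
apply: T_ind => [u v|u v|a|i j|i j].
- by rewrite rmorphB; apply: rpredB.
- by rewrite rmorphM; apply: rpredM.
- by apply: mem_gen_subring; left; exists a.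
- by apply: mem_gen_subring; right; exists i, j; left; rewrite !mxE.
- by apply: mem_gen_subring; right; exists i, j; right; rewrite !mxE.
Qed.

Lemma XYS : XS *m YS = 1%:M. Proof. by rewrite -map_mxM XYT map_mx1. Qed.
Lemma YXS : YS *m XS = 1%:M. Proof. by rewrite -map_mxM YXT map_mx1. Qed.

Lemma dXS : map_mx dS XS = map_mx pi WT *m XS.
Proof.
by rewrite -map_mxM -dXT; apply/matrixP => i j; rewrite !mxE pi_d.
Qed.

Lemma invXS : invmx XS = YS.
Proof.
apply: (@inv_unique _ XS); last exact: XYS.
by rewrite mulVmx //; have [] := mulmx1_unit XYS.
Qed.

Lemma CS_unitmx (m : 'M[C]_n) (M N : 'M[S]_n) :
  map_mx CS m = M -> M *m N = 1%:M -> m \in unitmx.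
Proof.
move=> mM MN; have := congr1 determinant MN; rewrite det_mulmx -mM det_map_mx det1.
rewrite unitmxE unitfE => E; apply: contraTneq isT => m0.
by move/eqP: E; rewrite m0 rmorph0 mul0r eq_sym oner_eq0.
Qed.

Hypothesis const_S : forall s, dS s = 0 -> exists a, s = CS a.

Section Automorphism.
Variable tau : {rmorphism S -> S}.
Hypotheses (tau_d : forall s, tau (dS s) = dS (tau s)).
Hypothesis (tau_F : forall a, tau (pi (tl a)) = pi (tl a)).

(** [tau] fixes the coefficients of the system, so [tau XS] is a second
    fundamental matrix and [YS *m tau XS] is constant. *)
Lemma automorphism_matrix : exists2 m : 'M[C]_n, m \in unitmx &
  YS *m map_mx tau XS = map_mx CS m.
Proof.
have dSd := dS_derivation.
have dY := der_invmx dSd XYS YXS dXS.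
have tW : map_mx tau (map_mx pi WT) = map_mx pi WT.
  by apply/matrixP => i j; rewrite !mxE /= tau_F.
have dtX : map_mx dS (map_mx tau XS) = map_mx pi WT *m map_mx tau XS.
  rewrite -tW -map_mxM -dXS; apply/matrixP => i j; rewrite !mxE tau_d //.
have dM : map_mx dS (YS *m map_mx tau XS) = 0.
  by rewrite (der_mulmx dSd) dY dtX mulNmx mulmxA addNr.
have ex i j : exists a, (YS *m map_mx tau XS) i j = CS a.
  by apply: const_S; move/matrixP/(_ i j): dM; rewrite !mxE.
pose m := \matrix_(i, j) projT1 (cid (ex i j)).
have mE : map_mx CS m = YS *m map_mx tau XS.
  by apply/matrixP => i j; rewrite 2!mxE; case: cid.
exists m => //; apply: (CS_unitmx mE (N := map_mx tau YS *m XS)).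
by rewrite mulmxA -[_ *m _ *m map_mx tau YS]mulmxA -map_mxM XYS map_mx1 mulmx1 YXS.
Qed.

(** An endomorphism of [P] over [D] extends to [T] by [F]-linearity. *)
Lemma lift_automorphism (tauP : {rmorphism P -> P}) (kP : {rmorphism C -> P}) m :
  (forall a, tr (kP a) = CT a) ->
  (forall u, tauP (f u) = f u) -> (forall p, pi (tr (tauP p)) = tau (pi (tr p))) ->
  map_mx tauP X = X *m map_mx kP m ->
  exists rho : {rmorphism T -> T}, [/\ forall a, rho (tl a) = tl a,
    map_mx rho XT = XT *m map_mx CT m & forall t, pi (rho t) = tau (pi t)].
Proof.
move=> kPE tf ptau tX.
have [|rho rhoE] := @tensor_lift _ _ _ c f T tl (tr \o tauP).
  by move=> u; rewrite /= tf tensr_baseT.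
have rl a : rho (tl a) = tl a by rewrite rhoE rmorph1 mulr1.
have rr p : rho (tr p) = tr (tauP p) by rewrite rhoE rmorph1 mul1r.
exists rho; split=> //.
  have -> : map_mx rho XT = map_mx tr (map_mx tauP X).
    by apply/matrixP => i j; rewrite !mxE rr.
  rewrite tX map_mxM; congr (_ *m _); apply/matrixP => i j; rewrite !mxE; exact: kPE.
move=> t; have := @rmorph_tensor_eq _ _ _ c f S (pi \o rho) (tau \o pi).
by apply=> [a|p] /=; rewrite ?rl ?rr ?tau_F ?ptau.
Qed.

End Automorphism.

(** [rho] descends to a delta-endomorphism of [S]; its kernel is a d-ideal of
    a simple ring, and it is onto because [rho] is. *)
Lemma stabilizer_automorphism (rho : {rmorphism T -> T}) m : bijective rho ->
  (forall a, rho (tl a) = tl a) -> map_mx rho XT = XT *m map_mx CT m ->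
  (forall t, I t -> I (rho t)) ->
  exists tau : {rmorphism S -> S},
  [/\ bijective tau, forall s, tau (dS s) = dS (tau s),
      forall a, tau (pi (tl a)) = pi (tl a),
      m \in unitmx & YS *m map_mx tau XS = map_mx CS m].
Proof.
move=> [rho' rK rK'] rl rX rI; have rd := rho_delta rl rX.
have ker t t' : pi t = pi t' -> pi (rho t) = pi (rho t').
  move=> tt'; apply/eqP; rewrite -subr_eq0 -!rmorphB; apply/eqP/pi_ker/rI/pi_ker.
  by rewrite rmorphB tt' subrr.
pose lift s := projT1 (cid (pi_surj s)).
have liftK s : pi (lift s) = s by rewrite /lift; case: cid.
pose tau0 s := pi (rho (lift s)).
have tau0E t : tau0 (pi t) = pi (rho t) by apply: ker; rewrite liftK.
have [|||tau tauE] := @rmorphism_of_fun S S tau0.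
- by move=> a b; rewrite -(liftK a) -(liftK b) -rmorphD !tau0E !rmorphD.
- by move=> a b; rewrite -(liftK a) -(liftK b) -rmorphM !tau0E !rmorphM.
- by have := tau0E 1; rewrite !rmorph1.
have tpi t : tau (pi t) = pi (rho t) by rewrite tauE.
have td s : tau (dS s) = dS (tau s).
  by rewrite -(liftK s) -pi_d !tpi rd pi_d.
have tX : YS *m map_mx tau XS = map_mx CS m.
  have -> : map_mx tau XS = map_mx pi (map_mx rho XT).
    by apply/matrixP => i j; rewrite !mxE tpi.
  rewrite rX map_mxM mulmxA YXS mul1mx; by apply/matrixP => i j; rewrite !mxE.
exists tau; split=> //.
- have tinj : injective tau.
    move=> a b tab; apply/eqP; rewrite -subr_eq0.
    pose N : set S := [set s | tau s = 0].
    have [_ /(_ N)] := S_simple; case.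
    + split; first split.
      * exact: rmorph0.
      * by move=> x y x0 y0; rewrite /N /= rmorphD x0 y0 addr0.
      * by move=> r x x0; rewrite /N /= rmorphM x0 mulr0.
      * by move=> x x0; rewrite /N /= td x0 (der0 dS_derivation).
    + by move=> N0; have : N (a - b) by [rewrite /N /= rmorphB tab subrr]; rewrite N0 => ->.
    + move=> NT; have : N 1 by rewrite NT.
      by rewrite /N /= rmorph1 => /eqP; rewrite oner_eq0.
  have tsurj s : tau (pi (rho' (lift s))) = s by rewrite tpi rK' liftK.
  exists (fun s => pi (rho' (lift s))) => s; last exact: tsurj.
  by apply: tinj; rewrite tsurj.
- by move=> a; rewrite tpi rl.
- apply: (CS_unitmx (esym tX) (N := map_mx tau YS *m XS)).
  by rewrite mulmxA -[_ *m _ *m map_mx tau YS]mulmxA -map_mxM XYS map_mx1 mulmx1 YXS.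
Qed.

End Specialization.

(** * The rings of the theorem *)

Section LocalizedRing.
Variables (DD : idomainType) (n : nat) (R : comUnitRingType).
Variables (iR : {rmorphism k0x DD -> R}) (X : 'M[R]_n) (h : {poly DD}).
Notation P := (calR iR X h).
Notation D := (Dring h).

Fact D_calR_zmod : zmod_morphism (@D_calR DD n R iR X h).
Proof. by move=> u v; apply: val_inj; rewrite /= !rmorphB. Qed.
Fact D_calR_monoid : monoid_morphism (@D_calR DD n R iR X h).
Proof. by split=> [|u v]; apply: val_inj; rewrite /= ?rmorph1 ?rmorphM. Qed.
HB.instance Definition _ := GRing.isZmodMorphism.Build D P (@D_calR DD n R iR X h) D_calR_zmod.
HB.instance Definition _ := GRing.isMonoidMorphism.Build D P (@D_calR DD n R iR X h) D_calR_monoid.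

Notation f := (@D_calR DD n R iR X h).
Notation jP := (\val : P -> R).

Hypothesis Xu : X \in unitmx.

Lemma val_X_calR : map_mx jP (X_calR iR X h) = X.
Proof. by apply/matrixP => i j; rewrite !mxE. Qed.

(** Cramer's rule. *)
Lemma invX_in i j : invmx X i j \in gen_subring (gens_calR iR X h).
Proof.
rewrite /invmx Xu !mxE; apply: rpredM.
  by apply: mem_gen_subring; right; right.
rewrite /cofactor; apply: rpredM; first by rewrite rpredX ?rpredN ?rpred1.
apply: rpred_sum => s _; apply: rpredM; first by rewrite rpredX ?rpredN ?rpred1.
by apply: rpred_prod => k _; rewrite !mxE X_calR_subproof.
Qed.

Definition Y_calR : 'M[P]_n := \matrix_(i, j) (Adjoin (invX_in i j) : P).

Lemma val_Y_calR : map_mx jP Y_calR = invmx X.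
Proof. by apply/matrixP => i j; rewrite !mxE. Qed.

Lemma map_val_inj (M N : 'M[P]_n) : map_mx jP M = map_mx jP N -> M = N.
Proof.
move/matrixP => MN; apply/matrixP => i j; apply: val_inj.
by have := MN i j; rewrite !mxE.
Qed.

Lemma XY_calR : X_calR iR X h *m Y_calR = 1%:M.
Proof. by apply: map_val_inj; rewrite map_mxM val_X_calR val_Y_calR mulmxV // map_mx1. Qed.
Lemma YX_calR : Y_calR *m X_calR iR X h = 1%:M.
Proof. by apply: map_val_inj; rewrite map_mxM val_X_calR val_Y_calR mulVmx // map_mx1. Qed.

(** 1/det X is the determinant of the inverse matrix, so it can be replaced by
    the entries of that matrix as a generator. *)
Lemma gen_calR (p : P) : p \in gen_subring
  (range f `|` [set p | exists i j, p = X_calR iR X h i j \/ p = Y_calR i j]).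
Proof.
set G := gen_subring _.
suff H r : r \in gen_subring (gens_calR iR X h) -> exists2 q : P, jP q = r & q \in G.
  by have [q /val_inj -> ] := H _ (valP p).
have GY i j : Y_calR i j \in G by apply: mem_gen_subring; right; exists i, j; right.
apply: (@gen_subring_ind _ _ (fun r => exists2 q : P, jP q = r & q \in G)).
- by exists 1; rewrite ?rmorph1 ?rpred1.
- by move=> a b [p1 <- Gp1] [p2 <- Gp2]; exists (p1 - p2); rewrite ?rmorphB ?rpredB.
- by move=> a b [p1 <- Gp1] [p2 <- Gp2]; exists (p1 * p2); rewrite ?rmorphM ?rpredM.
- move=> _ [[u _ <-]|[[i [j ->]]|->]].
  + by exists (f u) => //; apply: mem_gen_subring; left; exists u.
  + exists (X_calR iR X h i j); first by rewrite mxE.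
    by apply: mem_gen_subring; right; exists i, j; left.
  + exists (\det Y_calR).
      by rewrite -[LHS](det_map_mx jP) val_Y_calR det_inv.
    apply: rpred_sum => s _; apply: rpredM; first by rewrite rpredX ?rpredN ?rpred1.
    by apply: rpred_prod => k _.
Qed.

Hypothesis gen_R : forall r, r \in gen_subring (range iR `|` gens_X X).

Lemma den_calR r : exists (v : D) (p : P), v != 0 /\ iR (val v) * r = jP p.
Proof.
apply: (@den_generated _ R D P iR \val \val f val_inj _ (D_quot h)) (gen_R r) => // a aX.
have aP : a \in gen_subring (gens_calR iR X h) by apply: mem_gen_subring; right.
by exists (Adjoin aP : P).
Qed.

Lemma loc_h_D w : w \in loc_h h -> w \in gen_subring (gensD h).
Proof.
apply: (@gen_subring_ind _ _ (fun w => w \in gen_subring (gensD h))).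
- exact: rpred1.
- by move=> a b; apply: rpredB.
- by move=> a b; apply: rpredM.
- move=> _ [[p _ <-]|->]; first exact: poly_in_D.
  apply: mem_gen_subring; right; exists 0 => //.
  by rewrite /sigma_h rmorph0 addr0 comp_polyXr.
Qed.

End LocalizedRing.

Section BaseChange.
Variables (C : closedFieldType) (DD : idomainType).
Variables (iC : {rmorphism C -> DD}) (dD : DD -> DD).
Hypothesis hbase : base_hyp iC dD.
Variable h : {poly DD}.
Hypothesis h0 : h != 0.

Lemma base_char0 m : m.+1%:R != 0 :> DD.
Proof.
case: hbase => pC _ _ _ _; rewrite -(rmorph_nat iC) fmorph_eq0.
by move/pcharf0P: pC => ->.
Qed.

Lemma iC_const a : dD (iC a) = 0.
Proof. by case: hbase => _ _ _ dC _; apply/dC; exists a. Qed.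

(** On polynomials this holds because the point x is sent to is a constant; the
    remaining generators of D are inverses of polynomials. *)
Lemma specialization_delta (c2 : {rmorphism {poly C} -> C}) (c : {rmorphism Dring h -> k0 DD}) :
  extends_c2 iC c2 c -> forall u : Dring h, dk0 dD (c u) = c (delta_D dD u).
Proof.
move=> cE; case: (hbase) => _ ddD _ _ _.
have dk : derivation (dk0 dD) := frac_der_derivation ddD.
have dd := del_derivation ddD.
have dDrE := val_delta_D ddD h0.
have dDrd : @derivation (Dring h) (@delta_D _ dD h).
  split=> a b; apply: val_inj; rewrite dDrE.
    by rewrite !rmorphD /= !dDrE (derD dd).
  by rewrite !(rmorphD, rmorphM) /= !dDrE (derM dd).
have cp p : c (poly_D h p) = tofrac p.[iC (c2 'X)] by apply: cE.
have poly_case p : dk0 dD (c (poly_D h p)) = c (delta_D dD (poly_D h p)).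
  have -> : delta_D dD (poly_D h p) = poly_D h (map_poly dD p).
    by apply: val_inj; rewrite dDrE /= del_poly.
  rewrite !cp /dk0 frac_der_tofrac //; congr tofrac.
  elim/poly_ind: p => [|p a IH].
    by rewrite !map_poly0 ?(der0 ddD) // !horner0 (der0 ddD).
  have -> : map_poly dD (p * 'X + a%:P) = map_poly dD p * 'X + (dD a)%:P.
    have dm := map_poly_derivation ddD; rewrite (derD dm) (derM dm).
    have -> : map_poly dD 'X = 0.
      apply/polyP => i; rewrite coef_map_id0 ?(der0 ddD) // coefX coef0.
      by case: (i == 1)%N; rewrite ?(der0 ddD) ?(der1 ddD).
    rewrite mulr0 addr0; congr (_ + _).
    by apply/polyP => i; rewrite coef_map_id0 ?(der0 ddD) // !coefC; case: ifP; rewrite ?(der0 ddD).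
  by rewrite !hornerE (derD ddD) (derM ddD) iC_const mulr0 addr0 IH.
move=> u.
suff H w : w \in gen_subring (gensD h) -> exists2 v : Dring h, val v = w &
    dk0 dD (c v) = c (delta_D dD v).
  by have [v /val_inj ->] := H _ (valP u).
apply: (@gen_subring_ind _ _ (fun w => exists2 v : Dring h, val v = w &
    dk0 dD (c v) = c (delta_D dD v))).
- by exists 1; rewrite ?rmorph1 // (der1 dk) (der1 dDrd) rmorph0.
- move=> _ _ [v <- vE] [v' <- v'E]; exists (v - v'); first by rewrite rmorphB.
  by rewrite rmorphB (derB dk) (derB dDrd) rmorphB vE v'E.
- move=> _ _ [v <- vE] [v' <- v'E]; exists (v * v'); first by rewrite rmorphM.
  by rewrite rmorphM (derM dk) (derM dDrd) rmorphD !rmorphM vE v'E.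
- move=> b wP; have wD := mem_gen_subring wP; exists (Adjoin wD) => //.
  case: wP wD => [[p _ <-]|[i _ <-]] wD.
    have -> : Adjoin wD = poly_D h p by apply: val_inj.
    exact: poly_case.
  set v := Adjoin wD; set s := poly_D h (sigma_h h i).
  have sv : s * v = 1.
    apply: val_inj; rewrite /= mulfV // -(rmorph0 (@poly_k0x DD)).
    by rewrite (inj_eq (@poly_k0x_inj DD)) sigma_h_neq0.
  have csv : c s * c v = 1 by rewrite -rmorphM sv rmorph1.
  rewrite (der_inv dk csv) (der_inv dDrd sv) rmorphN rmorphM rmorphXn.
  by rewrite /s poly_case.
Qed.

End BaseChange.

Theorem theorem6p6
  (C : closedFieldType) (DD : idomainType)
  (iC : {rmorphism C -> DD}) (dD : DD -> DD)
  (hbase : base_hyp iC dD)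
  (n : nat) (A B : 'M[k0x DD]_n)
  (hAB : integrable_system dD A B)
  (R : comUnitRingType) (iR : {rmorphism k0x DD -> R})
  (sR : {rmorphism R -> R}) (dR : R -> R) (X : 'M[R]_n)
  (hPV : sd_picard_vessiot dD A B iR sR dR X)
  (h : {poly DD}) (h_neq0 : h != 0)
  (hA : forall i j, A i j \in loc_h h) (hB : forall i j, B i j \in loc_h h)
  (hcalR : calR_sd_subring iR sR dR X h)
  (c2 : {rmorphism {poly C} -> C}) (hc2 : forall a, c2 a%:P = a)
  (h_c2 : forall i : int, h.[iC (c2 'X) + i%:~R] != 0)
  (c2D : {rmorphism Dring h -> k0 DD}) (hc2D : extends_c2 iC c2 c2D)
  (T_neq0 : (1 : Tring iR X c2D) != 0)
  (I : set (Tring iR X c2D))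
  (hI : maximal_d_ideal (dT dD dR c2D) I)
  (S : comUnitRingType) (pi : {rmorphism Tring iR X c2D -> S}) (dS : S -> S)
  (hS : is_quotient dD dR pi dS I) :
  stab_is_dGal iC sR dR pi dS I.
Proof.
have ddD : derivation dD by case: hbase.
have DDs : d_simple dD by case: hbase.
case: (hPV) => [[_ dRd _] [iRs iRd] Rsimple [Xu sX dX] gen_R].
have [calRs calRd] := hcalR.
have iR_inj := fmorph_inj iR.
have [sK sKE] := restricted_rmorph iR_inj iRs.
pose D : comPzRingType := Dring h.
pose P : comPzRingType := calR iR X h.
pose jD : {rmorphism D -> k0x DD} := \val.
pose jP : {rmorphism P -> R} := \val.
pose f : {rmorphism D -> P} := @D_calR DD n R iR X h.
have jD_inj : injective jD := val_inj.
have jP_inj : injective jP := val_inj.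
pose dP : P -> P := restrict dR.
have jPd p : jP (dP p) = dR (jP p) by apply: val_restrict.
have jPs p : jP (restrict sR p) = sR (jP p).
  by apply: val_restrict => r rP; rewrite calRs.
have [sP sPE] := restricted_rmorph jP_inj jPs.
rewrite -sPE in jPs.
have dPd : derivation dP := restricted_derivation jP_inj dRd jPd.
have jDs u : jD (sigma_D u) = sK (jD u) by rewrite sKE; apply: val_sigma_D sKE u.
have jDd u : jD (delta_D dD u) = del dD (jD u) by apply: val_delta_D.
have iRsK q : iR (sK q) = sR (iR q) by rewrite sKE.
have Dtriv : sd_trivial (@sigma_D DD h) (@delta_D DD dD h).
  exact: (D_trivial ddD h_neq0 sKE (base_char0 hbase) DDs).
have den_K := D_quot h.
have den_R := den_calR h gen_R.
have jPf u : jP (f u) = iR (jD u) by [].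
have dPfE u : dP (f u) = f (delta_D dD u) := dPf jP_inj jPf jDd iRd jPd u.
pose XP : 'M[P]_n := X_calR iR X h.
pose YP : 'M[P]_n := Y_calR iR h Xu.
have XYP : XP *m YP = 1%:M := XY_calR iR h Xu.
have YXP : YP *m XP = 1%:M := YX_calR iR h Xu.
have gen_P := @gen_calR DD n R iR X h Xu.
pose AD : 'M[D]_n := \matrix_(i, j) (Adjoin (loc_h_D (hA i j)) : D).
pose BD : 'M[D]_n := \matrix_(i, j) (Adjoin (loc_h_D (hB i j)) : D).
have jfM (M : 'M[D]_n) : map_mx jP (map_mx f M) = map_mx iR (map_mx jD M).
  by apply/matrixP => i j; rewrite !mxE.
have jAD : map_mx jD AD = A by apply/matrixP => i j; rewrite !mxE.
have jBD : map_mx jD BD = B by apply/matrixP => i j; rewrite !mxE.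
have jXP : map_mx jP XP = X := val_X_calR iR X h.
have jXPij i j : jP (XP i j) = X i j by rewrite mxE.
have sXP : map_mx sP XP = map_mx f AD *m XP.
  apply: map_val_inj; rewrite -/jP map_mxM jfM jAD jXP -sX.
  by apply/matrixP => i j; rewrite [LHS]mxE [X in jP X]mxE jPs jXPij mxE.
have dXP : map_mx dP XP = map_mx f BD *m XP.
  apply: map_val_inj; rewrite -/jP map_mxM jfM jBD jXP -dX.
  by apply/matrixP => i j; rewrite [LHS]mxE [X in jP X]mxE jPd jXPij mxE.
pose iF : {rmorphism C -> k0 DD} := @tofrac DD \o iC.
have dFd : derivation (dk0 dD) := frac_der_derivation ddD.
have dF_C a : dk0 dD (iF a) = 0.
  by rewrite /dk0 frac_der_tofrac // (iC_const hbase) tofrac0.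
have dFc u : dk0 dD (c2D u) = c2D (delta_D dD u) := specialization_delta hbase h_neq0 hc2D u.
have [kD kDE] : exists kD : {rmorphism C -> D}, kD = (fun a => poly_D h (iC a)%:P) :> (_ -> _).
  apply: rmorphism_of_fun.
  - by move=> x y; apply: jD_inj; rewrite /= !rmorphD.
  - by move=> x y; apply: jD_inj; rewrite /= !rmorphM.
  - by apply: jD_inj; rewrite /= !rmorph1.
have c2kD a : c2D (kD a) = iF a.
  by rewrite kDE (hc2D (iC a)%:P) // hornerC.
have skD a : sP (f (kD a)) = f (kD a).
  apply: jP_inj; rewrite jPs -[jP (f _)]/(iR (jD (kD a))) -iRsK sKE kDE; congr (iR _).
  by rewrite /= sig_poly comp_polyC.
have dkD a : dP (f (kD a)) = 0.
  rewrite dPfE kDE; apply: jP_inj; rewrite rmorph0.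
  rewrite -[jP (f _)]/(iR (jD (delta_D dD (poly_D h (iC a)%:P)))).
  rewrite jDd /= del_poly // -(rmorph0 iR) -(rmorph0 (@poly_k0x DD)); congr (iR (poly_k0x _)).
  apply/polyP => i; rewrite coef_map_id0 ?(der0 ddD) // coefC coef0.
  by case: ifP; rewrite ?(iC_const hbase) ?(der0 ddD).
have [pi_surj pi_ker pi_dT] := hS.
have pi_d (t : tensor c2D f) : pi (tensor_der (dk0 dD) dP t) = dS (pi t) := pi_dT t.
pose tl := @tensl _ _ _ c2D f; pose tr := @tensr _ _ _ c2D f.
have dSd := dS_derivation dPd dFd dPfE dFc pi_surj pi_d.
have Ssimple := S_simple pi_surj pi_ker pi_d hI.
pose kS : {rmorphism k0 DD -> S} := pi \o @tensl _ _ _ c2D f.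
have const_S s : dS s = 0 -> exists a, s = pi (tl (iF a)).
  apply: (@simple_constants C DD iC dD hbase S dS kS dSd Ssimple _ n
    (map_mx pi (map_mx tr XP)) (map_mx pi (map_mx tr YP)) (map_mx c2D BD)).
  - by move=> a; rewrite /= -pi_d (dTl dPd dFd dPfE dFc).
  - exact: XYS.
  - exact: YXS.
  - rewrite (dXS dPd dFd dPfE dFc dXP pi_d); congr (_ *m _).
    by apply/matrixP => i j; rewrite !mxE.
  - by move=> s0; have := gen_S gen_P pi_surj s0.
have invX : invmx (Xbar pi) = map_mx pi (map_mx tr YP) := invXS XYP pi.
have fkD a : tr (f (kD a)) = tl (iF a) by rewrite -c2kD; exact: tensr_baseT.
have autM (tau : {rmorphism S -> S}) : in_dGal pi dS tau -> exists m, dGal_matrix iC pi tau m.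
  move=> [_ td tF]; have [m mu mE] :=
    automorphism_matrix dPd dFd dPfE dFc XYP YXP dXP pi_surj pi_d const_S td tF.
  by exists m; split=> //; rewrite invX.
(* every automorphism of S comes from a point g of G together with rho_g *)
have lift (tau : {rmorphism S -> S}) m : in_dGal pi dS tau -> dGal_matrix iC pi tau m ->
    exists (g : {rmorphism CG iR sR dR -> C}) (rho : {rmorphism tensor c2D f -> tensor c2D f}),
    [/\ in_G iC g, GZ X g = m, forall a, rho (tl a) = tl a,
        map_mx rho (map_mx tr XP) = map_mx tr XP *m map_mx (tl \o iF) m &
        forall t, pi (rho t) = tau (pi t)].
  move=> [_ td tF] [mu mE]; rewrite invX in mE.
  have sPfE u : sP (f u) = f (sigma_D u) := sPf jP_inj jPf jDs iRsK jPs u.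
  have [sQ sQE] := tensor_end_rmorph sPfE sPfE.
  have [F FE] := base_change jPf.
  pose eP : {rmorphism P -> S} := pi \o tensr c2D f.
  pose eP' : {rmorphism P -> S} := tau \o (pi \o tensr c2D f).
  pose kP : {rmorphism C -> P} := f \o kD.
  have ed p : dS (eP p) = eP (dP p) by rewrite /= -pi_d (dTr dPd dFd dPfE dFc).
  have ed' p : dS (eP' p) = eP' (dP p) by rewrite /= -td; congr (tau _); apply: ed.
  have ef u : eP' (f u) = eP (f u).
    have E : tr (f u) = tl (c2D u) := tensr_baseT f c2D u.
    by rewrite /eP' /eP /= -/tr E tF.
  have cS s : dS s = 0 -> exists a, s = eP (kP a).
    by move=> /const_S [a ->]; exists a; rewrite /eP /= -/tr fkD.
  have mE' : map_mx eP YP *m map_mx eP' XP = map_mx (eP \o kP) m.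
    have -> : map_mx (eP \o kP) m = map_mx (fun c => pi (C_T iC iR X c2D c)) m.
      by apply/matrixP => i j; rewrite !mxE /eP /= -/tr fkD.
    by rewrite -mE; congr (_ *m _); apply/matrixP => i j; rewrite !mxE.
  have [g [tauP [gC gZ tf tauE tX]]] :=
    torsor_point jD_inj jP_inj jPf den_K den_R dPd dRd jDs jDd iRsK iRd jPs jPd
      Rsimple Dtriv XYP YXP sXP dXP gen_P sQE FE dSd ed ed' ef
      (skD : forall a, sP (kP a) = kP a) (dkD : forall a, dP (kP a) = 0) cS mE'.
  have [rho [rF rX rE]] := lift_automorphism tF
    (fkD : forall a, tensr c2D f (kP a) = (tensl c2D f \o iF) a) tf tauE tX.
  exists g, rho; split=> //.
  - move=> a z zE; apply: gC; rewrite zE /C_RR; congr (tens iR iR (iR _) 1).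
    by rewrite kDE /= /poly_k0x map_polyC.
  - apply/matrixP => i j; have [z <- zE] := gZ i j.
    have zZ : Zmat iR X i j = val z.
      by rewrite zE mxE; apply: eq_bigr => l _; rewrite !mxE.
    by rewrite [LHS]mxE; congr (g _); rewrite mxE zZ valKd.
split=> //; apply/predeqP => m; split.
  (* the stabilizer acts on S through automorphisms *)
  move=> [g [gG [rho [[rb rF rX] rI]]] <-].
  have [tau [tb td tF mu tX]] :=
    stabilizer_automorphism dPd dFd dPfE dFc dF_C XYP YXP dXP gen_P
      pi_surj pi_ker pi_d hI rb rF rX rI.
  by exists tau => //; split=> //; rewrite invX.
move=> [tau tG tm]; have [g [rho [gG gZ rF rX rE]]] := lift tau m tG tm.
exists g => //; split=> //; exists rho; split; last first.
  by move=> t /pi_ker t0; apply/pi_ker; rewrite rE t0 rmorph0.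
have [tbij td tF] := tG; have [tau' tK tK'] := tbij.
(* rho is invertible because the inverse of tau lifts too *)
have [|||tau1 tau1E] := @rmorphism_of_fun S S tau'.
- by move=> x y; apply: (can_inj tK); rewrite rmorphD !tK'.
- by move=> x y; apply: (can_inj tK); rewrite rmorphM !tK'.
- by apply: (can_inj tK); rewrite rmorph1 tK'.
have tt1 s : tau (tau1 s) = s by rewrite tau1E tK'.
have t1G : in_dGal pi dS tau1.
  split; first by rewrite tau1E; exists tau.
    by move=> s; apply: (can_inj tK); rewrite td !tt1.
  by move=> a; apply: (can_inj tK); rewrite tt1 tF.
have [m1 tm1] := autM tau1 t1G.
have [g1 [rho1 [_ _ rF1 rX1 _]]] := lift tau1 m1 t1G tm1.
pose CS : {rmorphism C -> S} := pi \o (tensl c2D f \o iF).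
have YX : Xbar pi *m map_mx pi (map_mx tr YP) = 1%:M := XYS XYP pi.
have tauX (t : {rmorphism S -> S}) mt : dGal_matrix iC pi t mt ->
    map_mx t (Xbar pi) = Xbar pi *m map_mx CS mt.
  by move=> [_ tmE]; rewrite -[map_mx CS mt]tmE invX mulmxA YX mul1mx.
(* tau and tau1 are inverse to each other, and so are their matrices, which are constant *)
have mm1 : m *m m1 = 1%:M.
  have CSm : map_mx tau (map_mx CS m1) = map_mx CS m1.
    by apply/matrixP => i j; rewrite !mxE; apply: tF.
  have : map_mx tau (map_mx tau1 (Xbar pi)) = Xbar pi.
    by apply/matrixP => i j; rewrite !mxE tt1.
  rewrite (tauX _ _ tm1) map_mxM (tauX _ _ tm) CSm -mulmxA -map_mxM.
  move/(congr1 (mulmx (invmx (Xbar pi)))); rewrite mulmxA.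
  have -> : invmx (Xbar pi) *m Xbar pi = 1%:M by rewrite invX; apply: (YXS YXP pi).
  rewrite mul1mx -(map_mx1 CS) => /matrixP E; apply/matrixP => i j.
  by have := E i j; rewrite !mxE => /(fmorph_inj CS).
have comp_id (r1 r2 : {rmorphism tensor c2D f -> tensor c2D f}) (m' m'' : 'M[C]_n) :
    (forall a, r1 (tl a) = tl a) -> (forall a, r2 (tl a) = tl a) ->
    map_mx r1 (map_mx tr XP) = map_mx tr XP *m map_mx (tl \o iF) m' ->
    map_mx r2 (map_mx tr XP) = map_mx tr XP *m map_mx (tl \o iF) m'' ->
    m' *m m'' = 1%:M -> cancel r2 r1.
  move=> F1 F2 X1 X2 mm; apply: (T_rmorph_eq XYP YXP gen_P (g := r1 \o r2) (h := idfun)).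
    by move=> a; rewrite /= F2 F1.
  rewrite [LHS]map_mx_comp [X in map_mx r1 X]X2 map_mxM [map_mx r1 (map_mx tr XP)]X1.
  rewrite -[LHS]mulmxA [RHS]map_mx_id //.
  have -> : map_mx r1 (map_mx (tl \o iF) m'') = map_mx (tl \o iF) m''.
    by apply/matrixP => i j; rewrite !mxE; apply: F1.
  by rewrite -(map_mxM (tensl c2D f \o iF)) mm map_mx1 mulmx1.
split; [|exact: rF|by rewrite gZ].
exists rho1; first exact: comp_id rF1 rF rX1 rX (mulmx1C mm1).
exact: comp_id rF rF1 rX rX1 mm1.
Qed.
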